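(* (Matrix product formula for the inhomogeneous discrete time $U_q(A^{(1)}_2)$-zero range process.) Let $n=2$, let $L\ge1$ be an integer, and let $0<q<1$ and $0<\mu_i<\lambda<1$ for $i=1,\ldots,L$. Let $m=(m_1,m_2)$ with $m_1,m_2\ge1$. For $(\sigma_1,\ldots,\sigma_L)\in S(m)$ with $\sigma_i=(\sigma_{i,1},\sigma_{i,2})\in\mathbb{Z}_{\ge0}^2$, set $$\mathbb{P}(\sigma_1,\ldots,\sigma_L)=\left(\prod_{i=1}^L\frac{\mu_i^{-\sigma_{i,1}-\sigma_{i,2}}(\mu_i)_{\sigma_{i,1}+\sigma_{i,2}}}{(q)_{\sigma_{i,1}}(q)_{\sigma_{i,2}}}\right)\mathrm{Tr}\left(\frac{(\mathbf{b}_+)_\infty}{(\mu_1^{-1}\mathbf{b}_+)_\infty}\mathbf{k}^{\sigma_{1,2}}\mathbf{b}_-^{\sigma_{1,1}}\cdots\frac{(\mathbf{b}_+)_\infty}{(\mu_L^{-1}\mathbf{b}_+)_\infty}\mathbf{k}^{\sigma_{L,2}}\mathbf{b}_-^{\sigma_{L,1}}\right).$$ Then the trace is convergent and $\mathbb{P}(\sigma_1,\ldots,\sigma_L)$ is the (unnormalized) steady state probability in the sector $m$; that is, the vector $|\overline P(m)\rangle=\sum_{(\sigma_1,\ldots,\sigma_L)\in S(m)}\mathbb{P}(\sigma_1,\ldots,\sigma_L)|\sigma_1,\ldots,\sigma_L\rangle$ is nonzero and satisfies $T(\lambda|\mu_1,\ldots,\mu_L)|\overline P(m)\rangle=|\overline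 P(m)\rangle$.
   Context: Notation. $(z)_k=\prod_{j=1}^k(1-zq^{j-1})$; $\binom{k}{l}_q=\frac{(q)_k}{(q)_l(q)_{k-l}}$ if $0\le l\le k$ and $0$ otherwise; $\theta(\text{true})=1$, $\theta(\text{false})=0$; $|\alpha|=\alpha_1+\alpha_2$ for $\alpha\in\mathbb{Z}^2$. For $\alpha,\beta,\gamma,\delta\in\mathbb{Z}_{\ge0}^2$ put $$\Phi_q(\gamma|\beta;\lambda,\mu)=q^{(\beta_1-\gamma_1)\gamma_2}\Bigl(\frac{\mu}{\lambda}\Bigr)^{|\gamma|}\frac{(\lambda)_{|\gamma|}(\mu/\lambda)_{|\beta|-|\gamma|}}{(\mu)_{|\beta|}}\binom{\beta_1}{\gamma_1}_q\binom{\beta_2}{\gamma_2}_q$$ (which is $0$ unless $\gamma_i\le\beta_i$ for $i=1,2$), and $\mathscr{S}(\lambda,\mu)^{\gamma,\delta}_{\alpha,\beta}=\theta(\gamma+\delta=\alpha+\beta)\,\Phi_q(\gamma|\beta;\lambda,\mu)$. Let $W=\bigoplus_{\alpha\in\mathbb{Z}_{\ge0}^2}\mathbb{C}|\alpha\rangle$ and $|\alpha_1,\ldots,\alpha_L\rangle=|\alpha_1\rangle\otimes\cdots\otimes|\alpha_L\rangle\in W^{\otimes L}$. The Markov transfer matrix $T=T(\lambda|\mu_1,\ldots,\mu_L)$ is the linear operator on $W^{\otimes L}$ given by $T|\beta_1,\ldots,\beta_L\rangle=\sum_{\alpha_1,\ldots,\alpha_L}T^{\alpha_1,\ldots,\alpha_L}_{\beta_1,\ldots,\beta_L}|\alpha_1,\ldots,\alpha_L\rangle$,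 $$T^{\alpha_1,\ldots,\alpha_L}_{\beta_1,\ldots,\beta_L}=\sum_{\gamma_1,\ldots,\gamma_L\in\mathbb{Z}_{\ge0}^2}\ \prod_{i=1}^L\mathscr{S}(\lambda,\mu_i)^{\gamma_i,\alpha_i}_{\gamma_{i-1},\beta_i},\qquad \gamma_0:=\gamma_L$$ (all sums are finite). The discrete time process is $|P(t+1)\rangle=T|P(t)\rangle$. For $m\in\mathbb{Z}_{\ge0}^2$, $S(m)=\{(\sigma_1,\ldots,\sigma_L)\in(\mathbb{Z}_{\ge0}^2)^L:\sigma_1+\cdots+\sigma_L=m\}$; the span of the corresponding $|\sigma_1,\ldots,\sigma_L\rangle$ is the sector $m$, which $T$ preserves. A steady state in the sector is a nonzero vector of it fixed by $T$. The $q$-boson operators act on $F=\bigoplus_{r\ge0}\mathbb{C}|r\rangle$ by $\mathbf{b}_+|r\rangle=|r+1\rangle$, $\mathbf{b}_-|r\rangle=(1-q^r)|r-1\rangle$ (with $|-1\rangle=0$), $\mathbf{k}|r\rangle=q^r|r\rangle$. The ratio of infinite products means the power series $$\frac{(\mathbf{b}_+)_\infty}{(\mu^{-1}\mathbf{b}_+)_\infty}=\sum_{j\ge0}\frac{(\mu)_j}{(q)_j}\mu^{-j}\mathbf{b}_+^j,$$ operators being understood on the completed Fock space $\prod_{r\ge0}\mathbb{C}|r\rangle$. The trace is $\mathrm{Tr}(X)=\sum_{r\ge0}X_{r,r}$, where $X_{r,r}$ is the coefficient of $|r\rangle$ in $X|r\rangle$ (a finite expression for each $r$); ''convergent'' means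 that this series over $r$ converges. *)

(* Defs.v *)
From HB Require Import structures.
From mathcomp Require Import all_boot all_order all_algebra.
From mathcomp Require Import all_classical all_reals all_analysis.
From mathcomp Require Import finmap complex.
(* The notations of monalg clash with those of MathComp-Analysis. *)
From mathcomp Require Export -(notations) monalg.

Set Implicit Arguments.
Unset Strict Implicit.
Unset Printing Implicit Defensive.

Import Order.TTheory GRing.Theory Num.Theory.
Import numFieldNormedType.Exports.
Local Open Scope classical_set_scope.
Local Open Scope ring_scope.

(* A configuration (sigma_1, ..., sigma_L), sites being indexed from 0.  The
   sum of elements of nat * nat used below is the componentwise one. *)
Notation conf L := {ffun 'I_L -> nat * nat}.

Definition wt (a : nat * nat) : nat := (a.1 + a.2)%N.

Section Weights.
Variables (K : numFieldType) (q : K).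

Definition qpoch (z : K) (k : nat) : K := \prod_(j < k) (1 - z * q ^+ j).

Definition qbinom (k l : nat) : K :=
  if (l <= k)%N then qpoch q k / (qpoch q l * qpoch q (k - l)) else 0.

(* When the natural-number subtractions truncate, one of the two q-binomials
   vanishes. *)
Definition Phi (lambda mu : K) (c b : nat * nat) : K :=
  q ^+ ((b.1 - c.1) * c.2) * (mu / lambda) ^+ wt c
  * (qpoch lambda (wt c) * qpoch (mu / lambda) (wt b - wt c) / qpoch mu (wt b))
  * qbinom b.1 c.1 * qbinom b.2 c.2.

(* S(lambda, mu)^{c,d}_{a,b} *)
Definition Smx (lambda mu : K) (c d a b : nat * nat) : K :=
  (c + d == a + b)%:R * Phi lambda mu c b.

End Weights.

Section Process.
Variables (K : numFieldType) (L : nat) (q lambda : K) (mu : 'I_L -> K).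

(* T^{a_1,...,a_L}_{b_1,...,b_L}.  The sum has finite support, since Phi forces
   c_i <= b_i at every site; ord_pred is the cyclic predecessor. *)
Definition transfer_coef (a b : conf L) : K :=
  \sum_(c \in [set: conf L])
    \prod_(i < L) Smx q lambda (mu i) (c i) (a i) (c (ord_pred i)) (b i).

(* The tensor power of W is the free K-module malg (conf L) K on the configurations. *)
Definition ket (s : conf L) : malg (conf L) K := mkmalgU s 1.

(* T|b_1,...,b_L>; the support of the sum is finite, because
   a_i <= b_{i-1} + b_i whenever the coefficient is nonzero. *)
Definition transfer_ket (b : conf L) : malg (conf L) K :=
  \sum_(a \in [set: conf L]) transfer_coef a b *: ket a.

Definition transfer (v : malg (conf L) K) : malg (conf L) K :=
  \sum_(b <- msupp v) mcoeff b v *: transfer_ket b.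

Definition sector_confs (m : nat * nat) : set (conf L) :=
  [set s | \sum_(i < L) s i = m].

Definition in_sector (m : nat * nat) (v : malg (conf L) K) : Prop :=
  forall s, mcoeff s v != 0 -> sector_confs m s.

Definition steady_state (m : nat * nat) (v : malg (conf L) K) : Prop :=
  [/\ in_sector m v, v != 0 & transfer v = v].

End Process.

Section QBoson.
Variables (K : numFieldType) (q : K).

(* The completed Fock space: f stands for the formal sum of the f r |r>. *)
Definition fock : Type := nat -> K.

Definition fock_ket (r : nat) : fock := fun s => (s == r)%:R.

Definition bplus (f : fock) : fock := fun r => if r is s.+1 then f s else 0.

Definition bminus (f : fock) : fock := fun r => (1 - q ^+ r.+1) * f r.+1.

Definition kop (f : fock) : fock := fun r => q ^+ r * f r.

Lemma bplus_ket r : bplus (fock_ket r) = fock_ket r.+1.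
Proof. by apply/funext => -[|s]. Qed.

Lemma bminus_ket0 : bminus (fock_ket 0) = fun=> 0.
Proof. by apply/funext => s; rewrite /bminus /fock_ket mulr0. Qed.

Lemma bminus_ketS r :
  bminus (fock_ket r.+1) = fun s => (1 - q ^+ r.+1) * fock_ket r s.
Proof.
apply/funext => s; rewrite /bminus /fock_ket eqSS.
by case: eqP => [->|_]; rewrite ?mulr0.
Qed.

Lemma kop_ket r : kop (fock_ket r) = fun s => q ^+ r * fock_ket r s.
Proof.
apply/funext => s; rewrite /kop /fock_ket.
by case: eqP => [->|_]; rewrite ?mulr0.
Qed.

Lemma iter_bplus_lt j f r : (r < j)%N -> iter j bplus f r = 0.
Proof. by elim: j r => // j IHj [|r] //= /IHj. Qed.

(* (b_+)_oo / (mu^-1 b_+)_oo: by iter_bplus_lt the terms j > r of the power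
   series do not contribute to the component |r>. *)
Definition bplus_ratio (mu : K) (f : fock) : fock := fun r =>
  \sum_(j < r.+1) qpoch q mu j / qpoch q q j * mu ^- j * iter j bplus f r.

Definition diag (X : fock -> fock) : nat -> K := fun r => X (fock_ket r) r.

Definition trace_convergent (X : fock -> fock) : Prop := cvgn (series (diag X)).

Definition trace (X : fock -> fock) : K := limn (series (diag X)).

End QBoson.

Section MatrixProduct.
Variables (K : numFieldType) (L : nat) (q : K) (mu : 'I_L -> K).

(* The leftmost factor of the product is that of the first site. *)
Definition mp_operator (s : conf L) : fock K -> fock K :=
  \big[(fun X Y => X \o Y)/id]_(i < L)
    (bplus_ratio q (mu i) \o iter (s i).2 (kop q) \o iter (s i).1 (bminus q)).

Definition mp_prob (s : conf L) : K :=
  (\prod_(i < L) (mu i ^- wt (s i) * qpoch q (mu i) (wt (s i))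
                  / (qpoch q q (s i).1 * qpoch q q (s i).2)))
  * trace (mp_operator s).

(* The sum is finite, as sector_confs m is. *)
Definition mp_state (m : nat * nat) : malg (conf L) K :=
  \sum_(s \in sector_confs m) mp_prob s *: ket K s.

End MatrixProduct.

(* Main.v *)
(** Put z = b_+, b = b_-, X_a(mu) = V_mu k^{a_2} b^{a_1} with V_mu = (z)_oo / (z / mu)_oo.
    The factorization of Phi and the relation b k = q k b split every summand of
    T P into local factors, so that T P (a) is a trace of a product of the operators
      E_a = sum_{c <= a} g(c) h(a - c) k^{c_2} b^{c_1} V_mu k^{a_2 - c_2} b^{a_1 - c_1},
    after one cyclic move under the trace; g and h are the weights of (lambda, 1) and
    (mu, lambda).  The point is that E_a is proportional to V_lambda^{-1} X_a(mu) V_lambda,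
    and the conjugation by V_lambda disappears from the trace.

    For this identity take the generating operator c = b + x k.  Conjugation by V_{1/s}
    turns c into C + s D with C D = q D C, so powers of c multiply as q-exponentials:
    e(C + s D) = e(s D) e(C).  The identity then reduces to a cancellation of
    q-exponentials, and it holds coefficientwise in x. *)

Require Import Defs.
From HB Require Import structures.
From mathcomp Require Import all_boot all_order all_algebra.
From mathcomp Require Import all_classical all_reals all_analysis.
From mathcomp Require Import complex.
From mathcomp Require Import ring lra zify.

Set Implicit Arguments.
Unset Strict Implicit.
Unset Printing Implicit Defensive.

Import Order.TTheory GRing.Theory Num.Theory.
Import numFieldNormedType.Exports.
Local Open Scope ring_scope.

(** * q-exponential series *)

(** On an infinite-dimensional space neither convergence of the trace nor its invariance under
    cyclic moves is automatic. Both come from the factors k: as m_2 >= 1, every product contains at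
    least one, and its entries then decay geometrically along each diagonal, while V_mu and its
    inverse are constant along diagonals. The decay exponent adds up under products and equals the
    conserved sum of the second components, so it stays positive throughout.

    Series in t with operator coefficients are sequences under convolution, characterized by
    first-order q-difference equations. By contrast x is a scalar, and coefficients in x are
    compared at the end. The estimates are made over the reals; a ring morphism then carries the
    matrix entries to the complex numbers. *)

Section Convolution.
Variable A : nzRingType.
Implicit Types f g h : nat -> A.

Definition conv f g (n : nat) : A := \sum_(i < n.+1) f i * g (n - i)%N.

Definition conv1 (n : nat) : A := (n == 0)%:R.

Lemma conv1f f : conv conv1 f = f.
Proof.
apply/funext => n; rewrite /conv big_ord_recl /conv1 mul1r subn0 big1 ?addr0 //.
by move=> i _; rewrite mul0r.
Qed.

Lemma conv_coefM f g N n : (n < N)%N ->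
  conv f g n = ((\poly_(i < N) f i) * (\poly_(i < N) g i))`_n.
Proof.
move=> nN; rewrite coefM; apply: eq_bigr => i _; have := ltn_ord i => iN.
by rewrite !coef_poly !ifT //; lia.
Qed.

(** Coefficient n only sees indices at most n, so associativity is inherited from polynomials
    truncated there. *)
Lemma convA f g h : conv f (conv g h) = conv (conv f g) h.
Proof.
apply/funext => n; rewrite /conv.
pose P u := \poly_(i < n.+1) u i : {poly A}.
transitivity ((P f * (P g * P h))`_n).
  rewrite coefM; apply: eq_bigr => i _.
  by rewrite coef_poly ltn_ord -(@conv_coefM _ _ n.+1) // ltnS leq_subr.
rewrite mulrA coefM; apply: eq_bigr => i _.
by rewrite coef_poly ltnS leq_subr -(@conv_coefM _ _ n.+1).
Qed.

Lemma convC f g : (forall i j, f i * g j = g j * f i) -> conv f g = conv g f.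
Proof.
move=> fg; apply/funext => n; rewrite /conv (reindex_inj rev_ord_inj) /=.
by apply: eq_bigr => i _; rewrite subSS subKn // -ltnS.
Qed.

End Convolution.

Section QExponential.
Variables (K : numFieldType) (q : K).
Hypothesis q_nonroot : forall n, 1 - q ^+ n.+1 != 0.
Variable A : algType K.
Implicit Types (x C D : A) (l m p r s : K).

(** The homogeneous form l^n (p/l)_n of the q-shifted factorial. It still makes sense at l = 0,
    which lets [qexp x 0 l] be the inverse of [qexp x l 0]. *)
Definition qprod l p n : K := \prod_(j < n) (l - p * q ^+ j).

(* The coefficients in t of (p t x)_oo / (l t x)_oo. *)
Definition qexp x l p (n : nat) : A := (qprod l p n / qpoch q q n) *: x ^+ n.

Lemma qprodS l p n : qprod l p n.+1 = qprod l p n * (l - p * q ^+ n).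
Proof. by rewrite /qprod big_ord_recr. Qed.

Lemma qpochS z n : qpoch q z n.+1 = qpoch q z n * (1 - z * q ^+ n).
Proof. by rewrite /qpoch big_ord_recr. Qed.

Lemma qpoch_qq_neq0 n : qpoch q q n != 0.
Proof. by apply/prodf_neq0 => i _; rewrite -exprS q_nonroot. Qed.

Lemma qexp0 x l p : qexp x l p 0 = 1.
Proof. by rewrite /qexp /qprod /qpoch !big_ord0 divr1 scale1r. Qed.

Lemma qexpS x l p n :
  (1 - q ^+ n.+1) *: qexp x l p n.+1 = (l - p * q ^+ n) *: (x * qexp x l p n).
Proof.
rewrite /qexp qprodS qpochS -exprS -scalerAr -exprS !scalerA; congr (_ *: _).
by field; rewrite q_nonroot qpoch_qq_neq0.
Qed.

(** The recursion is the coefficient form of (1 - l t x) f(t) = (1 - p t x) f(q t). The product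
    formulas [qexp_trans] and [qexpD] are proved by checking it. *)
Lemma qexp_uniq x l p (f : nat -> A) : f 0%N = 1 ->
  (forall n, (1 - q ^+ n.+1) *: f n.+1 = (l - p * q ^+ n) *: (x * f n)) ->
  f = qexp x l p.
Proof.
move=> f0 fS; apply/funext; elim=> [|n IHn]; first by rewrite f0 qexp0.
by apply: (scalerI (q_nonroot n)); rewrite fS qexpS IHn.
Qed.

Lemma qexp_conv0 x y l p l' p' : conv (qexp x l p) (qexp y l' p') 0 = 1.
Proof. by rewrite /conv big_ord1 !qexp0 mul1r. Qed.

(** The q-Leibniz rule f(t) g(t) - f(qt) g(qt) = (f(t) - f(qt)) g(t) + f(qt) (g(t) - g(qt)), read
    off at t^(n+1). *)
Lemma convS (f g : nat -> A) n :
  (1 - q ^+ n.+1) *: conv f g n.+1 =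
  \sum_(i < n.+1) (((1 - q ^+ i.+1) *: f i.+1) * g (n - i)%N
    + (q ^+ i *: f i) * ((1 - q ^+ (n - i).+1) *: g (n - i).+1)).
Proof.
transitivity (\sum_(i < n.+2) (((1 - q ^+ i) *: f i) * g (n.+1 - i)%N
    + (q ^+ i *: f i) * ((1 - q ^+ (n.+1 - i)) *: g (n.+1 - i)%N))).
  rewrite /conv scaler_sumr; apply: eq_bigr => i _.
  rewrite -!scalerAl -scalerAr scalerA -scalerDl; congr (_ *: _).
  by rewrite -[in LHS](subnKC (ltnSE (ltn_ord i))) exprD; ring.
rewrite !big_split /=; congr (_ + _).
  by rewrite big_ord_recl /= expr0 subrr scale0r mul0r add0r.
rewrite big_ord_recr /= subnn expr0 subrr scale0r mulr0 addr0.
by apply: eq_bigr => i _; rewrite subSn // -ltnS.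
Qed.

Lemma qexp_trans x l p r : conv (qexp x l p) (qexp x p r) = qexp x l r.
Proof.
apply: qexp_uniq => [|n]; first exact: qexp_conv0.
rewrite convS /conv mulr_sumr scaler_sumr; apply: eq_bigr => i _.
rewrite !qexpS /qexp !(=^~ scalerAl, =^~ scalerAr) !mulrA -exprS -exprSr.
rewrite !scalerA -scalerDl; congr (_ *: _).
have -> : q ^+ n = q ^+ i * q ^+ (n - i) by rewrite -exprD subnKC // -ltnS.
by ring.
Qed.

Lemma qexp_id x l : qexp x l l = conv1 A.
Proof.
apply/funext => -[|n]; first by rewrite qexp0.
by rewrite /qexp /qprod big_ord_recl expr0 mulr1 subrr !mul0r scale0r.
Qed.

Lemma qexpC x l p l' p' :
  conv (qexp x l p) (qexp x l' p') = conv (qexp x l' p') (qexp x l p).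
Proof.
apply: convC => i j; rewrite /qexp -!scalerAl -!scalerAr -!exprD addnC.
by rewrite !scalerA mulrC.
Qed.

Lemma qexpK x l : conv (qexp x l 0) (qexp x 0 l) = conv1 A.
Proof. by rewrite qexp_trans qexp_id. Qed.

Lemma qexpVK x l : conv (qexp x 0 l) (qexp x l 0) = conv1 A.
Proof. by rewrite qexp_trans qexp_id. Qed.

Lemma qexp_split x l p : qexp x l p = conv (qexp x 0 p) (qexp x l 0).
Proof. by rewrite qexpC qexp_trans. Qed.

Section QPlane.
Variables C D : A.
Hypothesis CD : C * D = q *: (D * C).

Lemma qcomm_expr i : C * D ^+ i = q ^+ i *: (D ^+ i * C).
Proof.
elim: i => [|i IHi]; first by rewrite !expr0 mulr1 mul1r scale1r.
rewrite exprSr mulrA IHi -scalerAl -(mulrA (D ^+ i) C D) CD -scalerAr !mulrA scalerA.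
by rewrite -[q ^+ i * q]exprSr.
Qed.

(** Carrying C past D^i produces q^i, exactly the factor that the q-Leibniz rule puts in front of
    its second term; the two terms then add up to left multiplication by C + s D. *)
Lemma qexpD l s :
  qexp (C + s *: D) l 0 = conv (qexp D (l * s) 0) (qexp C l 0).
Proof.
apply/esym/qexp_uniq => [|n]; first exact: qexp_conv0.
rewrite convS /conv mulr_sumr scaler_sumr; apply: eq_bigr => i _.
rewrite !qexpS !mul0r !subr0 mulrDl scalerDr addrC; congr (_ + _).
  rewrite /qexp !(=^~ scalerAl, =^~ scalerAr) !mulrA qcomm_expr -!scalerAl !scalerA.
  by congr (_ *: _); ring.
by rewrite /qexp !(=^~ scalerAl, =^~ scalerAr) !mulrA !scalerA; congr (_ *: _); ring.
Qed.

Lemma qexpDV l s :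
  qexp (C + s *: D) 0 l = conv (qexp C 0 l) (qexp D 0 (l * s)).
Proof.
set X := _ + _; set Y := conv (qexp C 0 l) _.
have XY : conv (qexp X l 0) Y = conv1 A.
  rewrite qexpD /Y -convA (convA (qexp C l 0)) qexpK conv1f.
  by rewrite qexpK.
rewrite -[Y]conv1f -(qexpVK X l) -convA XY.
by rewrite convC ?conv1f // => i j; rewrite /conv1 mulr_natl mulr_natr.
Qed.

(* With e(u) = 1 / (u)_oo both sides equal
   e(p t C)^-1 e(l p t D)^-1 e(l m t D) e(m t C). *)
Lemma qexp_exchange l m p :
  conv (qexp (C + m *: D) l p) (qexp (C + p *: D) m l) = qexp (C + l *: D) m p.
Proof.
rewrite (qexp_split _ l p) (qexp_split _ m l) (qexp_split _ m p) !qexpD !qexpDV.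
rewrite -!convA; congr conv.
rewrite (convA (qexp C l 0)) qexpK conv1f (mulrC p l) (mulrC p m) (mulrC m l).
rewrite (convA (qexp D (l * m) 0)) (qexpC D (l * m)) !convA.
rewrite (qexpC D 0 (m * p)) -!convA (convA (qexp D 0 (m * p))).
rewrite (qexpC D 0 (m * p) (l * m)) -!convA (convA (qexp D 0 (m * p))) qexpVK conv1f.
by [].
Qed.

End QPlane.
End QExponential.

(** * Linear operators on the completed Fock space *)

Section Operators.
Variable K : numFieldType.

(** Only linearity is imposed: it suffices for an algebra over K, to which the q-exponential
    identities apply. Whether an operator acts through its matrix is a separate matter, treated by
    [band]. *)
Record fop := Fop {
  fop_fun :> fock K -> fock K;
  fop_linear : forall a f g, fop_fun (fun r => a * f r + g r)
    = fun r => a * fop_fun f r + fop_fun g r }.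

Lemma fop_ext (X Y : fop) : (forall f r, X f r = Y f r) -> X = Y.
Proof.
case: X Y => [X Xl] [Y Yl] /= XY.
have E : X = Y by apply/funext => f; apply/funext => r.
by case: Y / E Yl XY => Yl _; rewrite (Prop_irrelevance Xl Yl).
Qed.

HB.instance Definition _ := gen_eqMixin fop.
HB.instance Definition _ := gen_choiceMixin fop.

Lemma fop0_subproof a f g :
  (fun (_ : fock K) (_ : nat) => 0 : K) (fun r => a * f r + g r) = fun r => a * 0 + 0.
Proof. by apply/funext => r; rewrite mulr0 addr0. Qed.
Definition fop0 := Fop fop0_subproof.

Lemma fop1_subproof (a : K) (f g : fock K) :
  id (fun r => a * f r + g r) = fun r => a * f r + g r.
Proof. by []. Qed.
Definition fop1 := Fop fop1_subproof.

Lemma fop_opp_subproof (X : fop) a f g :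
  (fun r => - X (fun r => a * f r + g r) r) = fun r => a * (- X f r) + - X g r.
Proof. by apply/funext => r; rewrite fop_linear; ring. Qed.
Definition fop_opp X := Fop (fop_opp_subproof X).

Lemma fop_add_subproof (X Y : fop) a f g :
  (fun r => X (fun r => a * f r + g r) r + Y (fun r => a * f r + g r) r)
  = fun r => a * (X f r + Y f r) + (X g r + Y g r).
Proof. by apply/funext => r; rewrite !fop_linear; ring. Qed.
Definition fop_add X Y := Fop (fop_add_subproof X Y).

Lemma fop_scale_subproof c (X : fop) a f g :
  (fun r => c * X (fun r => a * f r + g r) r)
  = fun r => a * (c * X f r) + c * X g r.
Proof. by apply/funext => r; rewrite !fop_linear; ring. Qed.
Definition fop_scale c X := Fop (fop_scale_subproof c X).

Lemma fop_mul_subproof (X Y : fop) a f g :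
  (X \o Y) (fun r => a * f r + g r)
  = fun r => a * (X \o Y) f r + (X \o Y) g r.
Proof. by rewrite /= !fop_linear. Qed.
Definition fop_mul X Y := Fop (fop_mul_subproof X Y).

Fact fop_addA : associative fop_add.
Proof. by move=> X Y Z; apply: fop_ext => f r /=; rewrite addrA. Qed.
Fact fop_addC : commutative fop_add.
Proof. by move=> X Y; apply: fop_ext => f r /=; rewrite addrC. Qed.
Fact fop_add0 : left_id fop0 fop_add.
Proof. by move=> X; apply: fop_ext => f r /=; rewrite add0r. Qed.
Fact fop_addN : left_inverse fop0 fop_opp fop_add.
Proof. by move=> X; apply: fop_ext => f r /=; rewrite addNr. Qed.
HB.instance Definition _ :=
  GRing.isZmodule.Build fop fop_addA fop_addC fop_add0 fop_addN.

Fact fop_mulA : associative fop_mul.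
Proof. by move=> X Y Z; apply: fop_ext. Qed.
Fact fop_mul1 : left_id fop1 fop_mul.
Proof. by move=> X; apply: fop_ext. Qed.
Fact fop_mulr1 : right_id fop1 fop_mul.
Proof. by move=> X; apply: fop_ext. Qed.
Fact fop_mulDl : left_distributive fop_mul fop_add.
Proof. by move=> X Y Z; apply: fop_ext. Qed.
Fact fop_mulDr : right_distributive fop_mul fop_add.
Proof.
move=> X Y Z; apply: fop_ext => f r /=.
have -> : (fun s => Y f s + Z f s) = fun s => 1 * Y f s + Z f s.
  by apply/funext => s; rewrite mul1r.
by rewrite fop_linear mul1r.
Qed.
Fact fop_1neq0 : fop1 != 0.
Proof.
apply/eqP => /(congr1 (fun X : fop => X (fun=> 1) 0)) /= /eqP.
by rewrite oner_eq0.
Qed.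
HB.instance Definition _ := GRing.Zmodule_isNzRing.Build fop fop_mulA
  fop_mul1 fop_mulr1 fop_mulDl fop_mulDr fop_1neq0.

Fact fop_scaleA a b X : fop_scale a (fop_scale b X) = fop_scale (a * b) X.
Proof. by apply: fop_ext => f r /=; rewrite mulrA. Qed.
Fact fop_scale1 : left_id 1 fop_scale.
Proof. by move=> X; apply: fop_ext => f r /=; rewrite mul1r. Qed.
Fact fop_scaleDr : right_distributive fop_scale +%R.
Proof. by move=> a X Y; apply: fop_ext => f r /=; rewrite mulrDr. Qed.
Fact fop_scaleDl X : {morph fop_scale^~ X : a b / a + b}.
Proof. by move=> a b; apply: fop_ext => f r /=; rewrite mulrDl. Qed.
HB.instance Definition _ := GRing.Zmodule_isLmodule.Build K fop
  fop_scaleA fop_scale1 fop_scaleDr fop_scaleDl.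

Fact fop_scaleAl a (X Y : fop) : a *: (X * Y) = a *: X * Y.
Proof. exact: fop_ext. Qed.
HB.instance Definition _ := GRing.Lmodule_isLalgebra.Build K fop fop_scaleAl.

Fact fop_scaleAr a (X Y : fop) : a *: (X * Y) = X * (a *: Y).
Proof.
apply: fop_ext => f r /=.
have -> : (fun s => a * Y f s) = fun s => (a - 1) * Y f s + Y f s.
  by apply/funext => s; ring.
by rewrite fop_linear; ring.
Qed.
HB.instance Definition _ := GRing.Lalgebra_isAlgebra.Build K fop fop_scaleAr.

Lemma fop_sumE I (s : seq I) (P : pred I) (F : I -> fop) f r :
  (\sum_(i <- s | P i) F i) f r = \sum_(i <- s | P i) F i f r.
Proof. by elim/big_rec2: _ => // i _ y _ <-. Qed.

Lemma fop_mulE (X Y : fop) f : (X * Y) f = X (Y f). Proof. by []. Qed.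

Lemma fop_scaleE a (X : fop) f r : (a *: X) f r = a * X f r. Proof. by []. Qed.

Lemma fop_expE (X : fop) n f : (X ^+ n) f = iter n X f.
Proof. by elim: n => // n IHn; rewrite exprS fop_mulE IHn. Qed.

End Operators.

(** * Power series in the creation operator *)

Section PowerSeriesOperators.
Variable K : numFieldType.
Implicit Types (f g : nat -> K).

Lemma mser_subproof f a (g h : fock K) :
  conv f (fun r => a * g r + h r) = fun r => a * conv f g r + conv f h r.
Proof.
apply/funext => r; rewrite /conv mulr_sumr -big_split /=.
by apply: eq_bigr => i _; ring.
Qed.

(** With |r> read as z^r, this is multiplication by the power series with coefficients f; [zop] is
    then b_+, and all these operators commute. *)
Definition mser f : fop K := Fop (mser_subproof f).

Lemma mserM f g : mser f * mser g = mser (conv f g).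
Proof. by apply: fop_ext => h r; rewrite fop_mulE /= convA. Qed.

Lemma mser1 : mser (conv1 K) = 1.
Proof. by apply: fop_ext => h r; rewrite /= conv1f. Qed.

Lemma mserC f g : mser f * mser g = mser g * mser f.
Proof. by rewrite !mserM convC // => i j; rewrite mulrC. Qed.

Lemma mserD f g : mser f + mser g = mser (fun n => f n + g n).
Proof.
apply: fop_ext => h r; rewrite /= /conv -big_split /=.
by apply: eq_bigr => i _; rewrite mulrDl.
Qed.

Lemma mserZ a f : a *: mser f = mser (fun n => a * f n).
Proof.
apply: fop_ext => h r; rewrite fop_scaleE /= /conv mulr_sumr.
by apply: eq_bigr => i _; rewrite mulrA.
Qed.

Definition zseq (n : nat) : K := (n == 1)%:R.
Definition zop := mser zseq.

Lemma conv_zseq f n : conv zseq f n = if n is k.+1 then f k else 0.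
Proof.
rewrite /conv; case: n => [|n]; first by rewrite big_ord1 mul0r.
rewrite big_ord_recl mul0r add0r big_ord_recl /= mul1r subSS subn0 big1 ?addr0 //.
by move=> i _; rewrite mul0r.
Qed.

(** Identities involving b may thus be checked after multiplication by z, where z b = 1 - k
    eliminates b. *)
Lemma zop_inj (X Y : fop K) : zop * X = zop * Y -> X = Y.
Proof.
move=> E; apply: fop_ext => f r.
have := congr1 (fun Z : fop K => Z f r.+1) E.
by rewrite !fop_mulE /= !conv_zseq.
Qed.

Lemma one_sub_z a : 1 - a *: zop = mser (fun n => conv1 K n + -1 * (a * zseq n)).
Proof. by rewrite -mser1 /zop -scaleN1r !mserZ mserD. Qed.

Lemma conv_one_sub_z a f n :
  conv (fun n => conv1 K n + -1 * (a * zseq n)) f n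
  = f n - a * (if n is k.+1 then f k else 0).
Proof.
transitivity (conv (conv1 K) f n - a * conv zseq f n); last first.
  by rewrite conv1f conv_zseq.
by rewrite /conv mulr_sumr -sumrB; apply: eq_bigr => i _; ring.
Qed.

Lemma mser_rev4 f1 f2 f3 f4 :
  mser f1 * mser f2 * mser f3 * mser f4 = mser f4 * mser f3 * mser f2 * mser f1.
Proof.
rewrite !mserM -[LHS]mserM mserC -[in LHS]mserM (mserC _ f3) -(mserM f1) (mserC f1).
by rewrite !mulrA !mserM.
Qed.

Definition geo := mser (fun=> 1).

Lemma geoK : (1 - zop) * geo = 1.
Proof.
rewrite mulrBl mul1r /zop /geo mserM -scaleN1r mserZ mserD -mser1; congr mser.
by apply/funext => n; rewrite conv_zseq /conv1; case: n => [|n] /=; ring.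
Qed.

Lemma geoC : (1 - zop) * geo = geo * (1 - zop).
Proof. by rewrite mulrBl mulrBr mul1r mulr1 mserC. Qed.

End PowerSeriesOperators.

(** * The q-boson relations and conjugation by the infinite products *)

Section QBosonOperators.
Variables (K : numFieldType) (q : K).
Hypothesis q_nonroot : forall n, 1 - q ^+ n.+1 != 0.

Definition vcoef (l p : K) (n : nat) : K := qprod q l p n / qpoch q q n.

Lemma vcoefE l p : vcoef l p = qexp q (1 : K^o) l p.
Proof.
apply/funext => n.
by rewrite /qexp expr1n -mulr_algl mulr1 /GRing.scale /= mulr1.
Qed.

Lemma vcoef_conv l p r : conv (vcoef l p) (vcoef p r) = vcoef l r.
Proof. by rewrite !vcoefE; exact: (qexp_trans q_nonroot (1 : K^o) l p r). Qed.

Lemma vcoef_id l : vcoef l l = conv1 K.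
Proof. by rewrite vcoefE; exact: (qexp_id q (1 : K^o) l). Qed.

Lemma vcoefS l p n :
  (1 - q ^+ n.+1) * vcoef l p n.+1 = (l - p * q ^+ n) * vcoef l p n.
Proof.
rewrite vcoefE; have := qexpS q_nonroot (1 : K^o) l p n.
by rewrite mul1r.
Qed.

(* (z)_oo / (s z)_oo, so that [vop mu^-1] is [bplus_ratio mu]. *)
Definition vop (s : K) : fop K := mser (vcoef s 1).

Lemma bplus_ratioE (mu : K) (f : fock K) :
  mu != 0 -> bplus_ratio q mu f = vop mu^-1 f.
Proof.
move=> mu0; apply/funext => r; apply: eq_bigr => j _.
have -> : iter j (@bplus K) f r = f (r - j)%N.
  have : (j <= r)%N by rewrite -ltnS.
  move: (nat_of_ord j) => {}j; elim: j r => [|j IHj] r; first by rewrite subn0.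
  by case: r => // r jr; rewrite iterS /= IHj.
congr (_ * _); rewrite /vcoef mulrAC; congr (_ / _).
rewrite /qpoch /qprod -exprVn -[j in _ ^+ j]card_ord -prodr_const -big_split /=.
by apply: eq_bigr => i _; rewrite mulrBl mul1r mulrAC mulfV ?mul1r.
Qed.

Lemma kop_subproof a (f g : fock K) :
  kop q (fun r => a * f r + g r) = fun r => a * kop q f r + kop q g r.
Proof. by apply/funext => r; rewrite /kop; ring. Qed.
Definition kfop := Fop kop_subproof.

Lemma bminus_subproof a (f g : fock K) :
  bminus q (fun r => a * f r + g r) = fun r => a * bminus q f r + bminus q g r.
Proof. by apply/funext => r; rewrite /bminus; ring. Qed.
Definition bfop := Fop bminus_subproof.

Local Notation z := (zop K).
Local Notation k := kfop.
Local Notation b := bfop.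

Lemma fopBE (X Y : fop K) f r : (X - Y) f r = X f r - Y f r. Proof. by []. Qed.

Lemma zb : z * b = 1 - k.
Proof.
apply: fop_ext => f r; rewrite fop_mulE fopBE /= conv_zseq /kop /bminus.
by case: r => [|r]; rewrite ?expr0; ring.
Qed.

Lemma kz : k * z = q *: (z * k).
Proof.
apply: fop_ext => f r; rewrite fop_mulE fop_scaleE fop_mulE /= /kop !conv_zseq.
by case: r => [|r]; rewrite ?mulr0 // exprS mulrA.
Qed.

Lemma bk : b * k = q *: (k * b).
Proof.
apply: fop_ext => f r; rewrite fop_mulE fop_scaleE fop_mulE /= /kop /bminus.
by rewrite exprS; ring.
Qed.

Lemma k_mser f : k * mser f = mser (fun n => q ^+ n * f n) * k.
Proof.
apply: fop_ext => h r; rewrite !fop_mulE /= /kop /conv mulr_sumr.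
apply: eq_bigr => i _; have : q ^+ r = q ^+ i * q ^+ (r - i).
  by rewrite -exprD subnKC // -ltnS.
by move=> ->; ring.
Qed.

(** k V(z) = V(q z) k, and for V(z) = (z)_oo / (s z)_oo the quotient V(q z) / V(z) is (1 - s z) / (1
    - z); the denominator is cleared. *)
Lemma k_vop s : (1 - z) * (k * vop s) = (1 - s *: z) * (vop s * k).
Proof.
rewrite k_mser !mulrA; congr (_ * _); rewrite -[z in 1 - z]scale1r !one_sub_z !mserM.
congr mser; apply/funext => n; rewrite !conv_one_sub_z.
case: n => [|n]; first by rewrite expr0; ring.
have := vcoefS s 1 n; rewrite mul1r => E.
apply/eqP; rewrite -subr_eq0; apply/eqP.
transitivity ((s - q ^+ n) * vcoef s 1 n - (1 - q ^+ n.+1) * vcoef s 1 n.+1).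
  ring.
by rewrite E subrr.
Qed.

Section Exchange.
Variable x : K.

Let c : fop K := b + x *: k.
(** Origin of D: conjugating z c = 1 - (1 - x z) k by [vop s] multiplies k by (1 - s z) / (1 - z),
    which gives 1 - (1 - s z) D. This is (1 - D) + s z D, so cancelling z leaves C + s D with z C =
    1 - D. *)
Let D : fop K := geo K * (1 - x *: z) * k.
Let C : fop K := c - D.

Let DE : (1 - z) * D = (1 - x *: z) * k.
Proof. by rewrite /D !mulrA geoK mul1r. Qed.

Let zc : z * c = 1 - (1 - x *: z) * k.
Proof. by rewrite mulrDr zb -scalerAr mulrBl mul1r opprB addrAC -scalerAl addrA. Qed.

Let zC : z * C = 1 - D.
Proof.
rewrite mulrBr zc -DE mulrBl mul1r opprB addrA; apply/eqP.
by rewrite subr_eq addrAC.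
Qed.

Let Dz : D * z = q *: (z * D).
Proof.
rewrite /D -mulrA kz -scalerAr; congr (_ *: _); rewrite !mulrA; congr (_ * _).
have zx : (1 - x *: z) * z = z * (1 - x *: z).
  by rewrite mulrBl mulrBr mul1r mulr1 -scalerAl -scalerAr.
by rewrite -(mulrA (geo K)) zx !mulrA; congr (_ * _); apply: mserC.
Qed.

Let CD : C * D = q *: (D * C).
Proof.
(* Multiplied by z, the claim becomes (1 - D) D = D (1 - D), because D z = q z D. *)
apply: zop_inj; rewrite mulrA zC -scalerAr (mulrA z D) (scalerAl q (z * D)).
rewrite -Dz -mulrA zC.
by rewrite mulrBl mulrBr mul1r mulr1.
Qed.

Let c_vop s : c * vop s = vop s * (C + s *: D).
Proof.
apply: zop_inj; rewrite mulrA zc (mulrA z) [z * vop s]mserC -mulrA.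
rewrite [z * _]mulrDr zC -scalerAr.
rewrite -addrA mulrDr mulr1 mulrBl mul1r; congr (_ + _).
have -> : - D + s *: (z * D) = - ((1 - s *: z) * D).
  by rewrite mulrBl mul1r opprB addrC scalerAl.
rewrite mulrN; congr (- _).
rewrite -[_ * k * vop s]mulrA.
rewrite [k * vop s](_ : _ = geo K * (1 - s *: z) * vop s * k); last first.
  by rewrite -!mulrA -k_vop [geo K * _]mulrA -geoC geoK mul1r.
rewrite /D !mulrA; congr (_ * _).
by rewrite !one_sub_z; apply: mser_rev4.
Qed.

Lemma cexp_vop n s : c ^+ n * vop s = vop s * (C + s *: D) ^+ n.
Proof.
elim: n => [|n IHn]; first by rewrite !expr0 mulr1 mul1r.
by rewrite exprSr -mulrA c_vop mulrA IHn -mulrA -exprSr.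
Qed.

(** Moving every [vop] to the left replaces c by C + m D in the first series and by C + l D in the
    series on the right; the second series keeps c = C + D. What remains is [qexp_exchange] with p =
    1. *)
Lemma c_exchange l m :
  conv (fun n => vop l * qexp q c l 1 n) (fun n => vop m * qexp q c m l n) =
  fun n => vop m * qexp q c m 1 n * vop l.
Proof.
have cE : C + 1 *: D = c by rewrite scale1r subrK.
have vC : vop m * vop l = vop l * vop m by apply: mserC.
apply/funext => n; rewrite -mulrA {2}/qexp -scalerAl cexp_vop scalerAr -/(qexp q _ m 1 n).
rewrite -(qexp_exchange q_nonroot CD l m 1) mulrA vC -mulrA /conv !mulr_sumr.
apply: eq_bigr => i _; rewrite cE -mulrA; congr (_ * _).
by rewrite /qexp mulrA -[in LHS]scalerAl cexp_vop scalerAr mulrA.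
Qed.

End Exchange.
End QBosonOperators.

(** * Extraction of coefficients in x *)

Section TriangularSums.
Variable V : nmodType.

Lemma sum_triangle (F : nat -> nat -> V) N :
  \sum_(n < N.+1) \sum_(i < n.+1) F i (n - i)%N =
  \sum_(i < N.+1) \sum_(j < (N - i).+1) F i j.
Proof.
transitivity (\sum_(n < N.+1) \sum_(i < N.+1 | (i <= n)%N) F i (n - i)%N).
  apply: eq_bigr => n _.
  by rewrite (big_ord_widen N.+1 (fun i => F i (n - i)%N)) // ltnS -ltnS.
rewrite (exchange_big_dep xpredT) //=; apply: eq_bigr => i _.
rewrite -(big_geq_mkord i N.+1 xpredT (fun n => F i (n - i)%N)).
rewrite -[in LHS](add0n i) big_addn subSn; last by rewrite -ltnS.
by rewrite big_mkord; apply: eq_bigr => j _; rewrite addnK.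
Qed.

Lemma sum_triangle_sym (F : nat -> nat -> V) N :
  \sum_(i < N.+1) \sum_(j < (N - i).+1) F i j =
  \sum_(j < N.+1) \sum_(i < (N - j).+1) F i j.
Proof.
rewrite -sum_triangle -(sum_triangle (fun j i => F i j)); apply: eq_bigr => n _.
rewrite (reindex_inj rev_ord_inj) /=; apply: eq_bigr => i _.
by rewrite subSS subKn // -ltnS.
Qed.

(** Both sides run over all (i, j, i', j') with total N. The left side groups by i + j, the degree
    in t of the first series; the right side by i + i', the degree in x. *)
Lemma sum_degree_split (G : nat -> nat -> nat -> nat -> V) N :
  \sum_(n < N.+1) \sum_(i < n.+1) \sum_(i' < (N - n).+1)
     G i (n - i)%N i' (N - n - i')%N =
  \sum_(a < N.+1) \sum_(i < a.+1) \sum_(j < (N - a).+1)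
     G i j (a - i)%N (N - a - j)%N.
Proof.
pose H i j := \sum_(i' < (N - (i + j)).+1) G i j i' (N - (i + j) - i')%N.
transitivity (\sum_(n < N.+1) \sum_(i < n.+1) H i (n - i)%N).
  apply: eq_bigr => n _; apply: eq_bigr => i _; rewrite /H.
  by rewrite subnKC // -ltnS.
pose H' i i' := \sum_(j < (N - (i + i')).+1) G i j i' (N - (i + i') - j)%N.
transitivity (\sum_(n < N.+1) \sum_(i < n.+1) H' i (n - i)%N); last first.
  apply: eq_bigr => n _; apply: eq_bigr => i _; rewrite /H'.
  by rewrite subnKC // -ltnS.
rewrite !sum_triangle; apply: eq_bigr => i _; rewrite /H /H'.
under eq_bigr => j _ do rewrite subnDA.
under [RHS]eq_bigr => j _ do rewrite subnDA.
rewrite (sum_triangle_sym (fun j i' => G i j i' (N - i - j - i')%N)).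
by apply: eq_bigr => j _; apply: eq_bigr => i' _; congr G; exact: subnAC.
Qed.

End TriangularSums.

(** In characteristic 0 the naturals provide more roots than a nonzero polynomial admits. *)
Lemma poly_coef_inj (K : numFieldType) (f g : nat -> K) n :
  (forall x, \sum_(i < n) x ^+ i * f i = \sum_(i < n) x ^+ i * g i) ->
  forall i, (i < n)%N -> f i = g i.
Proof.
move=> fg i lin; pose P := \poly_(i < n) (f i - g i).
have P0 : P = 0.
  apply/eqP/negP => /negP Pn0.
  pose rs : seq K := [seq j%:R | j <- iota 0 (size P)].
  suff : (size rs < size P)%N by rewrite size_map size_iota ltnn.
  apply: max_poly_roots => //.
    apply/allP => _ /mapP[j _ ->]; apply/rootP; rewrite horner_poly.
    under eq_bigr do rewrite mulrBl mulrC [X in _ - X]mulrC.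
    by rewrite sumrB fg subrr.
  by rewrite map_inj_uniq ?iota_uniq // => a b /eqP; rewrite eqr_nat => /eqP.
have /eqP := congr1 (fun P : {poly K} => P`_i) P0.
by rewrite coef_poly lin coef0 subr_eq0 => /eqP.
Qed.

Section ExchangeComponents.
Variables (K : numFieldType) (q : K).
Hypothesis q_nonroot : forall n, 1 - q ^+ n.+1 != 0.
Local Notation vop := (vop q).
Local Notation k := (kfop q).
Local Notation b := (bfop q).

Definition kb (i j : nat) : fop K := k ^+ i * b ^+ j.
Definition kbq i j : fop K := (qpoch q q i * qpoch q q j)^-1 *: kb i j.

Lemma qprod0r l n : qprod q l 0 n = l ^+ n.
Proof.
rewrite -[n in RHS]card_ord -prodr_const /qprod.
by apply: eq_bigr => i _; rewrite mul0r subr0.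
Qed.

(** The noncommutative q-binomial theorem for b k = q k b, as a case of [qexpD]. *)
Lemma qexp_kb x l p n :
  qexp q (b + x *: k) l p n =
  qprod q l p n *: \sum_(i < n.+1) x ^+ i *: kbq i (n - i)%N.
Proof.
have -> : qexp q (b + x *: k) l p n = qprod q l p n *: qexp q (b + x *: k) 1 0 n.
  by rewrite /qexp scalerA qprod0r expr1n mul1r.
congr (_ *: _); rewrite (qexpD q_nonroot (bk q)) mul1r; apply: eq_bigr => i _.
rewrite /qexp !qprod0r expr1n -!scalerAl -!scalerAr !scalerA; congr (_ *: _).
by rewrite invfM mul1r mulrA.
Qed.

(** The coefficient of x^a in degree a + a' of [c_exchange]. It is extracted after evaluation at a
    vector and a component, since [poly_coef_inj] compares scalars. *)
Lemma kb_exchange l m a a' :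
  \sum_(i < a.+1) \sum_(j < a'.+1)
    (qprod q l 1 (i + j) * qprod q m l ((a - i) + (a' - j))) *:
       (vop l * kbq i j * vop m * kbq (a - i) (a' - j)) =
  qprod q m 1 (a + a') *: (vop m * kbq a a' * vop l).
Proof.
apply: fop_ext => f r; set N := (a + a')%N.
pose G i j i' j' := (qprod q l 1 (i + j) * qprod q m l (i' + j')) *:
  (vop l * kbq i j * vop m * kbq i' j').
pose lhs a := (\sum_(i < a.+1) \sum_(j < (N - a).+1)
    G i j (a - i)%N (N - a - j)%N) f r.
pose rhs a := (qprod q m 1 N *: (vop m * kbq a (N - a) * vop l)) f r.
have Na : (N - a)%N = a' by rewrite /N addKn.
suff : lhs a = rhs a by rewrite /lhs /rhs Na.
apply: (@poly_coef_inj _ lhs rhs N.+1); last by rewrite ltnS leq_addr.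
move=> x.
have := congr1 (fun g : nat -> fop K => g N f r) (c_exchange q_nonroot x l m).
rewrite /conv.
have -> : vop m * qexp q (b + x *: k) m 1 N * vop l =
   \sum_(i < N.+1) x ^+ i *: (qprod q m 1 N *: (vop m * kbq i (N - i) * vop l)).
  rewrite qexp_kb -scalerAr -scalerAl mulr_sumr mulr_suml scaler_sumr.
  by apply: eq_bigr => i _; rewrite -scalerAr -scalerAl !scalerA mulrC.
have -> : \sum_(n < N.+1) vop l * qexp q (b + x *: k) l 1 n *
     (vop m * qexp q (b + x *: k) m l (N - n)) =
   \sum_(n < N.+1) \sum_(i < n.+1) \sum_(i' < (N - n).+1)
     x ^+ (i + i') *: G i (n - i)%N i' (N - n - i')%N.
  apply: eq_bigr => n _; rewrite !qexp_kb !(=^~ scalerAl, =^~ scalerAr).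
  rewrite [vop l * _]mulr_sumr [vop m * _]mulr_sumr mulr_suml.
  rewrite !scaler_sumr; apply: eq_bigr => i _.
  rewrite mulr_sumr !scaler_sumr; apply: eq_bigr => i' _.
  rewrite /G !subnKC -1?ltnS // -!scalerAr -!scalerAl !scalerA.
  by rewrite exprD !mulrA; congr (_ *: _); ring.
rewrite (sum_degree_split (fun i j i' j' => x ^+ (i + i') *: G i j i' j')).
rewrite !fop_sumE => E.
pose S i := \sum_(i' < i.+1) \sum_(j < (N - i).+1)
  x ^+ (i' + (i - i')) *: G i' j (i - i')%N (N - i - j)%N.
have L i : S i f r = x ^+ i * lhs i; last first.
  transitivity (\sum_(i < N.+1) S i f r); last exact: E.
  by apply: eq_bigr => i _; rewrite L.
rewrite /lhs -fop_scaleE scaler_sumr; congr (fop_fun _ f r).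
apply: eq_bigr => j _.
rewrite scaler_sumr; apply: eq_bigr => j' _.
by rewrite subnKC // -ltnS.
Qed.

(** Pulling b^e1 through k^c2 yields the power of q that occurs in [Phi]; the operator of a site
    with content c + e thus splits into those of e and c. *)
Lemma kb_split c1 c2 e1 e2 :
  q ^+ (e1 * c2) *: kb (e2 + c2) (e1 + c1) = kb e2 e1 * kb c2 c1.
Proof.
have H n : b ^+ n * k ^+ c2 = q ^+ (n * c2) *: (k ^+ c2 * b ^+ n).
  elim: n => [|n IHn]; first by rewrite expr0 mulr1 mul1r scale1r.
  rewrite exprS -mulrA IHn -scalerAr (mulrA b) (qcomm_expr (bk q)) -scalerAl scalerA.
  by rewrite -exprD addnC mulSn mulrA.
by rewrite /kb !exprD -!mulrA (mulrA (b ^+ e1)) H -scalerAl -scalerAr !mulrA.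
Qed.

End ExchangeComponents.

(** * Convergence and cyclicity of the trace *)

Section Tame.
Variables (R : realType) (q : R).
Hypothesis hq : 0 < q < 1.
Implicit Types X Y : fop R.

Let q0 : 0 < q. Proof. by case/andP: hq. Qed.
Let q1 : q < 1. Proof. by case/andP: hq. Qed.

Definition entry X (r s : nat) : R := X (fock_ket R s) r.

Arguments entry : simpl never.

(** On the full product space a linear operator is not determined by its matrix. Here X is required
    to act through it, with row r ending at column r + d. *)
Definition band d X := forall f r, X f r = \sum_(s < (r + d).+1) entry X r s * f s.

(* The matrix of X has at most d diagonals above the main one, and the entries
   along each diagonal decay like q^(j r). *)
Definition tame j X := (exists d, band d X) /\
  forall e, exists2 C, 0 <= C &
    forall r s, (r <= s + e)%N -> `|entry X r s| <= C * (q ^+ j) ^+ r.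

Lemma band_entry0 d X r s : band d X -> (r + d < s)%N -> entry X r s = 0.
Proof.
move=> Xd rs; rewrite /entry Xd big1 // => i _.
by rewrite /fock_ket ltn_eqF ?mulr0 // (leq_trans _ rs).
Qed.

Lemma sum_entry_widen d X (f : fock R) r N : band d X -> (r + d < N)%N ->
  \sum_(s < N) entry X r s * f s = \sum_(s < (r + d).+1) entry X r s * f s.
Proof.
move=> Xd rN; rewrite (big_ord_widen N (fun s => entry X r s * f s) rN).
rewrite [RHS]big_mkcond; apply: eq_bigr => s _; case: ifPn => //.
by rewrite ltnS -ltnNge => h; rewrite (band_entry0 Xd h) mul0r.
Qed.

Lemma band_widen d d' X : (d <= d')%N -> band d X -> band d' X.
Proof. by move=> dd' Xd f r; rewrite (sum_entry_widen _ Xd) ?Xd //; lia. Qed.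

Lemma entryM d X Y r s : band d X ->
  entry (X * Y) r s = \sum_(t < (r + d).+1) entry X r t * entry Y t s.
Proof. by move=> Xd; rewrite {1}/entry fop_mulE Xd. Qed.

Lemma band_mul d d' X Y : band d X -> band d' Y -> band (d + d') (X * Y).
Proof.
move=> Xd Yd f r; rewrite fop_mulE Xd.
transitivity (\sum_(t < (r + d).+1) \sum_(s < (r + (d + d')).+1)
   entry X r t * entry Y t s * f s).
  apply: eq_bigr => t _; rewrite Yd -(@sum_entry_widen _ _ _ _ (r + (d + d')).+1 Yd).
    by rewrite mulr_sumr; apply: eq_bigr => s _; rewrite mulrA.
  by have := ltn_ord t; lia.
rewrite exchange_big; apply: eq_bigr => s _ /=.
by rewrite -mulr_suml -(entryM Y r s Xd).
Qed.

Lemma expr_le1 n : 0 <= q ^+ n <= 1.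
Proof. by rewrite exprn_ge0 ?exprn_ile1 // ltW. Qed.

Lemma expr_anti m n : (n <= m)%N -> q ^+ m <= q ^+ n.
Proof. by move=> nm; rewrite ler_wiXn2l // ltW. Qed.

Lemma entry_mul_bound i j X Y : tame i X -> tame j Y ->
  forall e, exists2 C, 0 <= C & forall r t s, (r <= t + e)%N -> (t <= s + e)%N ->
    `|entry X r t * entry Y t s| <= C * (q ^+ (i + j)) ^+ r.
Proof.
move=> [_ hX] [_ hY] e; have [C C0 hC] := hX e; have [C' C'0 hC'] := hY e.
(* Since t >= r - e, the decay of Y at t is the decay at r up to a factor q^-(j e). *)
exists (C * C' * q ^- (j * e)).
  by rewrite !mulr_ge0 // invr_ge0 exprn_ge0 // ltW.
move=> r t s rt ts; rewrite normrM.
apply: (le_trans (ler_pM _ _ (hC _ _ rt) (hC' _ _ ts))) => //.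
have -> : C * C' * q ^- (j * e) * (q ^+ (i + j)) ^+ r
   = C * (q ^+ i) ^+ r * (C' * (q ^+ (j * r) * q ^- (j * e))).
  by rewrite exprD exprMn (exprM q j r); ring.
apply: ler_wpM2l; first by rewrite mulr_ge0 // -exprM exprn_ge0 // ltW.
apply: ler_wpM2l => //; rewrite -exprM ler_pdivlMr ?exprn_gt0 // -exprD.
by apply: expr_anti; rewrite -mulnDr leq_mul2l rt orbT.
Qed.

Lemma sum_ord_lt n m (B : R) : 0 <= B ->
  \sum_(u < n) (if (u < m)%N then B else 0) <= m%:R * B.
Proof.
move=> B0; have -> : \sum_(u < n) (if (u < m)%N then B else 0) = (minn n m)%:R * B.
  elim: n => [|n IHn]; first by rewrite big_ord0 min0n mul0r.
  rewrite big_ord_recr /= IHn; case: ltnP => nm.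
    have -> : minn n.+1 m = n.+1 by lia.
    by rewrite -[n.+1]addn1 natrD mulrDl mul1r.
  by rewrite addr0; congr (_%:R * _); lia.
by rewrite ler_wpM2r // ler_nat geq_minr.
Qed.

Lemma tame_mul i j X Y : tame i X -> tame j Y -> tame (i + j) (X * Y).
Proof.
move=> tX tY; have [[d Xd] _] := tX; have [[d' Yd] _] := tY.
split; first by exists (d + d')%N; apply: band_mul.
(* A nonzero term needs t <= r + d and s <= t + d'; with r <= s + e this leaves at most E + 1 values
   of t. *)
move=> e; pose E := (e + d + d')%N.
have [C C0 hC] := entry_mul_bound tX tY E.
exists (E.+1%:R * C); first by rewrite mulr_ge0.
move=> r s rs; rewrite (entryM Y r s Xd) (reindex_inj rev_ord_inj) /=.
set B := C * (q ^+ (i + j)) ^+ r.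
have B0 : 0 <= B by rewrite mulr_ge0 // -exprM exprn_ge0 // ltW.
rewrite -mulrA; apply: le_trans (sum_ord_lt (r + d).+1 E.+1 B0).
apply: le_trans (ler_norm_sum _ _ _) _; apply: ler_sum => u _.
set t := (_ - _)%N; have ht : t = (r + d - u)%N by rewrite /t; lia.
case: ltnP => uE; first by apply: hC; rewrite ht /E; lia.
rewrite (band_entry0 (r := t) Yd) ?mulr0 ?normr0 // ht.
by move: uE; rewrite /E; have := ltn_ord u; lia.
Qed.

Lemma tame1 : tame 0 1.
Proof.
have E r s : entry 1 r s = (r == s)%:R by [].
split.
  exists 0%N => f r; rewrite addn0 big_ord_recr /= E eqxx mul1r big1 ?add0r //.
  by move=> s _; rewrite E gtn_eqF ?mul0r.
move=> e; exists 1 => // r s _; rewrite E expr0 expr1n mulr1.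
by case: eqP => _; rewrite ?normr1 ?normr0.
Qed.

Lemma tameZ j a X : tame j X -> tame j (a *: X).
Proof.
move=> [[d Xd] hX]; have E r s : entry (a *: X) r s = a * entry X r s by [].
split.
  exists d => f r; rewrite fop_scaleE Xd mulr_sumr.
  by apply: eq_bigr => s _; rewrite E mulrA.
move=> e; have [C C0 hC] := hX e; exists (`|a| * C); first by rewrite mulr_ge0.
by move=> r s rs; rewrite E normrM -mulrA ler_wpM2l // hC.
Qed.

Lemma tameD j X Y : tame j X -> tame j Y -> tame j (X + Y).
Proof.
move=> [[d Xd] hX] [[d' Yd] hY].
have E r s : entry (X + Y) r s = entry X r s + entry Y r s by [].
split.
  exists (maxn d d') => f r.
  have -> : (X + Y) f r = X f r + Y f r by [].
  rewrite (band_widen (leq_maxl d d') Xd) (band_widen (leq_maxr d d') Yd) -big_split.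
  by apply: eq_bigr => s _; rewrite E mulrDl.
move=> e; have [C C0 hC] := hX e; have [C' C'0 hC'] := hY e.
exists (C + C'); first by rewrite addr_ge0.
move=> r s rs; rewrite E mulrDl; apply: le_trans (ler_normD _ _) _.
by apply: lerD; [apply: hC | apply: hC'].
Qed.

Lemma tame0 j : tame j 0.
Proof.
have E r s : entry 0 r s = 0 by [].
split; first by exists 0%N => f r; rewrite big1 // => s _; rewrite E mul0r.
by move=> e; exists 0 => // r s _; rewrite E normr0 mul0r.
Qed.

Lemma tame_prod I (r : seq I) (j : I -> nat) (F : I -> fop R) :
  (forall i, tame (j i) (F i)) ->
  tame (\sum_(i <- r) j i) (\prod_(i <- r) F i).
Proof.
move=> tF; elim/big_rec2: _ => [|i X n _ tX]; first exact: tame1.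
exact: tame_mul.
Qed.

Lemma tame_exp j X n : tame j X -> tame (n * j) (X ^+ n).
Proof.
move=> tX; elim: n => [|n IHn]; first by rewrite mul0n expr0; exact: tame1.
by rewrite exprS mulSn; apply: tame_mul.
Qed.

(** Entries are constant along each diagonal, so each bound involves finitely many coefficients,
    however fast f grows. *)
Lemma tame_mser f : tame 0 (mser f).
Proof.
have E r s : entry (mser f) r s = if (s <= r)%N then f (r - s)%N else 0.
  rewrite /entry /= /conv; case: leqP => rs.
    have h : (r - s < r.+1)%N by lia.
    rewrite (bigD1 (Ordinal h)) //= /fock_ket subKn // eqxx mulr1 big1 ?addr0 //.
    move=> i; rewrite -val_eqE /= => irs.
    rewrite (_ : (r - i == s)%N = false) ?mulr0 //.
    by have := ltn_ord i; lia.
  rewrite big1 // => i _; rewrite /fock_ket (_ : (r - i == s)%N = false) ?mulr0 //.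
  by lia.
split.
  exists 0%N => g r; rewrite addn0 /= /conv (reindex_inj rev_ord_inj) /=.
  apply: eq_bigr => s _; rewrite subSS E -ltnS ltn_ord subKn //.
  by rewrite -ltnS.
move=> e; exists (\sum_(i < e.+1) `|f i|); first exact: sumr_ge0.
move=> r s rs; rewrite E expr0 expr1n mulr1; case: leqP => sr; last first.
  by rewrite normr0 sumr_ge0.
have h : (r - s < e.+1)%N by lia.
by rewrite (bigD1 (Ordinal h)) //= lerDl sumr_ge0.
Qed.

Lemma tame_kfop : tame 1 (kfop q).
Proof.
have E r s : entry (kfop q) r s = q ^+ r * (r == s)%:R by [].
split.
  exists 0%N => f r; rewrite addn0 big_ord_recr /= E eqxx mulr1 big1 ?add0r //.
  by move=> s _; rewrite E gtn_eqF ?mulr0 ?mul0r.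
move=> e; exists 1 => // r s _; rewrite E expr1 mul1r normrM.
have /andP[h _] := expr_le1 r; rewrite (ger0_norm h).
by case: eqP => _; rewrite ?normr1 ?normr0 ?mulr1 ?mulr0.
Qed.

Lemma tame_bfop : tame 0 (bfop q).
Proof.
have E r s : entry (bfop q) r s = (1 - q ^+ r.+1) * (r.+1 == s)%:R by [].
split.
  exists 1%N => f r; rewrite addn1 big_ord_recr /= E eqxx mulr1 big1 ?add0r //.
  by move=> s _; rewrite E gtn_eqF ?mulr0 ?mul0r.
move=> e; exists 1 => // r s _; rewrite E expr0 expr1n mulr1 normrM.
have /andP[h h'] := expr_le1 r.+1; rewrite (@ger0_norm _ (1 - _)) ?subr_ge0 //.
by case: eqP => _; rewrite ?normr1 ?normr0 ?mulr1 ?mulr0 ?lerBlDr ?lerDl.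
Qed.

Lemma geometric_cvg0 (u : nat -> R) C n0 :
  (forall n, (n0 <= n)%N -> `|u n| <= C * q ^+ n) -> (u n @[n --> \oo] --> 0)%classic.
Proof.
move=> hu.
have g0 : ((C * q ^+ n) @[n --> \oo] --> 0)%classic.
  by apply: cvg_geometric; rewrite ger0_norm // ltW.
have c0 : ((0 : R) @[n --> \oo] --> (0 : R))%classic by apply: cvg_cst.
apply/norm_cvg0P; apply: (squeeze_cvgr _ c0 g0).
by exists n0 => // n /= hn; rewrite normr_ge0 hu.
Qed.

Lemma diagE X r : diag X r = entry X r r. Proof. by []. Qed.

Lemma tame_cvg j X : (0 < j)%N -> tame j X -> trace_convergent X.
Proof.
move=> j0 [_ hX]; have [C C0 hC] := hX 0%N.
apply: normed_cvg; apply: (@series_le_cvg _ _ (geometric C q)).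
- by move=> n; apply: normr_ge0.
- by move=> n; rewrite /geometric /= mulr_ge0 // exprn_ge0 // ltW.
- move=> n; rewrite /= diagE; apply: le_trans (hC n n _) _; first by rewrite addn0.
  rewrite ler_wpM2l // -exprM; apply: expr_anti.
  by rewrite -[n in (n <= _)%N]mul1n leq_mul2r j0 orbT.
- by apply: is_cvg_geometric_series; rewrite ger0_norm // ltW.
Qed.

Lemma traceZ a X : trace_convergent X -> trace (a *: X) = a * trace X.
Proof. exact: lim_seriesZ. Qed.

Lemma traceD X Y : trace_convergent X -> trace_convergent Y ->
  trace (X + Y) = trace X + trace Y.
Proof. exact: lim_seriesD. Qed.

Lemma trace0 : trace (0 : fop R) = 0.
Proof.
rewrite /trace /series /=; apply: cvg_lim => //.
rewrite (_ : (fun n => _) = fun=> 0); first exact: cvg_cst.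
by apply/funext => n; rewrite big1.
Qed.

Lemma trace_sum j I (r : seq I) (P : pred I) (F : I -> fop R) : (0 < j)%N ->
  (forall i, P i -> tame j (F i)) ->
  trace (\sum_(i <- r | P i) F i) = \sum_(i <- r | P i) trace (F i).
Proof.
move=> j0 tF; suff [] : tame j (\sum_(i <- r | P i) F i) /\
  trace (\sum_(i <- r | P i) F i) = \sum_(i <- r | P i) trace (F i) by [].
elim/big_rec2: _ => [|i x X Pi [tX IH]].
  by split; [exact: tame0 | exact: trace0].
split; first by apply: tameD => //; apply: tF.
by rewrite traceD ?IH //; apply: (tame_cvg j0) => //; apply: tF.
Qed.

(** The partial trace of X Y and the square truncation of the double sum differ only in terms with
    row below n and column at least n. As X has at most d diagonals above the main one, these are at
    most d^2 terms near the corner (n, n), where the entries decay. *)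
Lemma trace_mul_boundary i j X Y : (0 < i + j)%N -> tame i X -> tame j Y ->
  (series (diag (X * Y)) n
     - \sum_(r < n) \sum_(s < n) entry X r s * entry Y s r @[n --> \oo] --> 0)%classic.
Proof.
move=> ij tX tY; have [[d Xd] _] := tX.
pose F r s := entry X r s * entry Y s r.
pose G n := \sum_(u < d) \sum_(v < d) F (n - u.+1)%N (n + v)%N.
have Gn n : (d <= n)%N ->
  series (diag (X * Y)) n - \sum_(r < n) \sum_(s < n) F r s = G n.
  have -> : series (diag (X * Y)) n = \sum_(r < n) entry (X * Y) r r.
    by rewrite /series /= big_mkord.
  move=> dn; rewrite -sumrB.
  transitivity (\sum_(r < n) \sum_(v < d) F r (n + v)%N).
    apply: eq_bigr => r _; rewrite (entryM Y r r Xd).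
    rewrite -(@sum_entry_widen _ _ (fun t => entry Y t r) r (n + d) Xd); last first.
      by have := ltn_ord r; lia.
    rewrite big_split_ord; apply/eqP; rewrite subr_eq addrC; apply/eqP.
    by congr (_ + _).
  rewrite (reindex_inj rev_ord_inj) /= /G.
  rewrite (big_ord_widen n (fun u => \sum_(v < d) F (n - u.+1)%N (n + v)%N) dn).
  rewrite [RHS]big_mkcond; apply: eq_bigr => u _; case: ltnP => // du.
  rewrite big1 // => v _; rewrite /F (band_entry0 Xd) ?mul0r //.
  by have := ltn_ord u; lia.
have G0 : (G n @[n --> \oo] --> 0)%classic.
  have [C C0 hC] := entry_mul_bound tX tY (d + d).
  (* The row index is at least n - d, whence the factor q^-d. *)
  apply: (@geometric_cvg0 _ (\sum_(u < d) \sum_(v < d) C * q ^- d) d) => n dn.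
  rewrite mulr_suml; apply: le_trans (ler_norm_sum _ _ _) _.
  apply: ler_sum => u _.
  rewrite mulr_suml; apply: le_trans (ler_norm_sum _ _ _) _.
  apply: ler_sum => v _.
  have hu := ltn_ord u; have hv := ltn_ord v.
  apply: le_trans (hC _ _ _ _ _) _; [lia | lia |].
  rewrite -mulrA ler_wpM2l // -exprM mulrC ler_pdivlMr ?exprn_gt0 // -exprD.
  apply: expr_anti; apply: (@leq_trans (n - u.+1 + d)%N); first by lia.
  by rewrite leq_add2r -[leqLHS]mul1n leq_mul2r ij orbT.
apply: cvg_trans G0; apply: near_eq_cvg.
by exists d => // n /= dn; rewrite Gn.
Qed.

(** The square truncations for X Y and for Y X coincide, and each partial trace is asymptotic to its
    truncation. *)
Lemma traceC i j X Y : (0 < i + j)%N -> tame i X -> tame j Y ->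
  trace (X * Y) = trace (Y * X).
Proof.
move=> ij tX tY.
have cXY : trace_convergent (X * Y) by apply: (tame_cvg ij); apply: tame_mul.
have cYX : trace_convergent (Y * X).
  by apply: (@tame_cvg (j + i)); [rewrite addnC | apply: tame_mul].
have h1 := trace_mul_boundary ij tX tY.
have h2 : (series (diag (Y * X)) n
     - \sum_(r < n) \sum_(s < n) entry Y r s * entry X s r @[n --> \oo] --> 0)%classic.
  by apply: (@trace_mul_boundary j i) => //; rewrite addnC.
apply/eqP; rewrite -subr_eq0; apply/eqP.
rewrite /trace -limB //; apply: cvg_lim; first exact: norm_hausdorff.
have := @cvgB _ _ _ _ eventually_filter _ _ _ _ h1 h2.
rewrite subr0; apply: cvg_trans.
apply: near_eq_cvg; near=> n.
have S : \sum_(r < n) \sum_(s < n) entry Y r s * entry X s r =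
    \sum_(r < n) \sum_(s < n) entry X r s * entry Y s r.
  rewrite exchange_big /=; apply: eq_bigr => r _.
  by apply: eq_bigr => s _; rewrite mulrC.
rewrite [LHS](_ : _ = series (diag (X * Y)) n
    - \sum_(r < n) \sum_(s < n) entry X r s * entry Y s r
  - (series (diag (Y * X)) n - \sum_(r < n) \sum_(s < n) entry Y r s * entry X s r)) //.
by rewrite S opprB addrA subrK.
Unshelve. all: by end_near.
Qed.

End Tame.

(** * Cyclic rotation of products *)

Lemma prod_regroup (A : pzRingType) (f g : nat -> A) n :
  f 0%N * \prod_(i < n) (g i * f i.+1) = (\prod_(i < n) (f i * g i)) * f n.
Proof.
elim: n => [|n IHn]; first by rewrite !big_ord0 mulr1 mul1r.
by rewrite !big_ord_recr /= mulrA IHn !mulrA.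
Qed.

(** Both products share the word Y from the first F to the last F; only the last G changes ends,
    because [ord_pred] sends the first index to the last. *)
Lemma prod_rotate (A : pzRingType) (n : nat) (F G : 'I_n.+1 -> A) :
  let Y := (\prod_(i < n) (F (inord i) * G (inord i))) * F ord_max in
  \prod_(i < n.+1) (F i * G i) = Y * G ord_max /\
  \prod_(i < n.+1) (G (ord_pred i) * F i) = G ord_max * Y.
Proof.
pose f k := F (inord k); pose g k := G (inord k).
have fE i : F i = f i by rewrite /f inord_val.
have gE i : G i = g i by rewrite /g inord_val.
split.
  rewrite big_ord_recr /= mulrA; congr (_ * _ * _).
  by apply: eq_bigr => i _; rewrite fE gE.
rewrite [F ord_max]fE -[X in _ = _ * X](prod_regroup f g) big_ord_recl mulrA.
have -> : ord_pred (ord0 : 'I_n.+1) = ord_max.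
  by apply: val_inj; rewrite /= modn_small.
rewrite [F ord0]fE; congr (_ * _); apply: eq_bigr => i _; rewrite fE /g.
congr (G _ * _); apply: val_inj; have hi := ltn_ord i.
rewrite /= inordK; last by lia.
by rewrite modnDr modn_small ?add0n // ltnW // ltnS.
Qed.

Lemma prod_intertwine (A : pzRingType) I (r : seq I) (F G : I -> A) v :
  (forall i, v * F i = G i * v) ->
  v * \prod_(i <- r) F i = (\prod_(i <- r) G i) * v.
Proof.
move=> FG; elim: r => [|i r IHr]; first by rewrite !big_nil mulr1 mul1r.
by rewrite !big_cons mulrA FG -mulrA IHr mulrA.
Qed.

Section Trace.
Variables (R : realType) (q : R).
Hypothesis hq : 0 < q < 1.

Lemma trace_rotate n (F G : 'I_n.+1 -> fop R) (a b : 'I_n.+1 -> nat) :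
  (forall i, tame q (a i) (F i)) -> (forall i, tame q (b i) (G i)) ->
  (0 < \sum_i (a i + b i))%N ->
  trace (\prod_(i < n.+1) (F i * G i)) =
  trace (\prod_(i < n.+1) (G (ord_pred i) * F i)).
Proof.
move=> tF tG ab; have [-> ->] := prod_rotate F G.
have tY : tame q (\sum_(i < n) (a (inord i) + b (inord i)) + a ord_max)
    ((\prod_(i < n) (F (inord i) * G (inord i))) * F ord_max).
  apply: tame_mul => //; apply: tame_prod => // i; exact: tame_mul.
apply: (traceC hq _ tY (tG _)); move: ab; rewrite big_ord_recr /= addnA.
congr (0 < _ + _ + _)%N; apply: eq_bigr => i _.
suff -> : widen_ord (leqnSn n) i = inord i by [].
by apply: val_inj; rewrite /= inordK //; have := ltn_ord i; lia.
Qed.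

End Trace.

(** * Factorization of the local weights and stationarity under the trace *)

Section Weight.
Variables (K : numFieldType) (q : K).
Hypothesis q_nonroot : forall n, 1 - q ^+ n.+1 != 0.

(* With s = mu^-1 and p = 1 this is the weight mu^-|a| (mu)_|a| / ((q)_a1 (q)_a2). *)
Definition weight (s p : K) (a : nat * nat) : K :=
  qprod q s p (wt a) / (qpoch q q a.1 * qpoch q q a.2).

Definition npsub (a b : nat * nat) : nat * nat := ((a.1 - b.1)%N, (a.2 - b.2)%N).
Definition nple (a b : nat * nat) : bool := (a.1 <= b.1)%N && (a.2 <= b.2)%N.

Lemma qprod_qpoch m l n : m != 0 -> qprod q m^-1 l n = m ^- n * qpoch q (m * l) n.
Proof.
move=> m0; rewrite /qprod /qpoch -exprVn -[n in _ ^+ n]card_ord.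
rewrite -prodr_const -big_split /=.
by apply: eq_bigr => i _; rewrite mulrBr mulr1 !mulrA mulVf // mul1r.
Qed.

(** The weight of b cancels (mu)_|b| and the q-factorials of b in [Phi]; what is left separates into
    a factor for c and one for b - c. The power of q is reserved for [kb_split]. *)
Lemma Phi_weight lambda mu c b : lambda != 0 -> mu != 0 ->
  (forall n, qpoch q mu n != 0) -> nple c b ->
  Phi q lambda mu c b * weight mu^-1 1 b =
  q ^+ ((b.1 - c.1) * c.2) *
  (weight lambda^-1 1 c * weight mu^-1 lambda^-1 (npsub b c)).
Proof.
move=> l0 m0 mu_nz /andP[c1 c2]; rewrite /Phi /weight /qbinom c1 c2.
have -> : wt (npsub b c) = (wt b - wt c)%N by rewrite /wt /npsub /=; lia.
have wbc : wt b = (wt c + (wt b - wt c))%N by rewrite /wt; lia.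
rewrite !qprod_qpoch // !mulr1 expr_div_n.
have -> : mu ^- wt b = mu ^- wt c * mu ^- (wt b - wt c).
  by rewrite -invfM -exprD -wbc.
have Q := qpoch_qq_neq0 q_nonroot; rewrite /npsub /=.
field; rewrite !Q mu_nz !expf_neq0 //.
Qed.

Lemma Phi_eq0 lambda mu c b : ~~ nple c b -> Phi q lambda mu c b = 0.
Proof.
rewrite negb_and /Phi /qbinom; case: leqP => [_|_ _] /=; last by rewrite mulr0 mul0r.
by case: leqP => // _ _; rewrite mulr0.
Qed.

End Weight.

Section Stationarity.
Variables (R : realType) (q : R) (N : nat).
Hypothesis hq : 0 < q < 1.
Let J : finType := ('I_N * 'I_N)%type.

Lemma q_nonroot_real n : 1 - q ^+ n.+1 != 0.
Proof.
have /andP[q0 q1] := hq; rewrite subr_eq0 eq_sym lt_eqF //.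
by rewrite exprn_ilt1 // ltW.
Qed.

Definition pnat (c : J) : nat * nat := (c.1 : nat, c.2 : nat).

Definition site_op (a : nat * nat) : fop R := kb q a.2 a.1.

Lemma tame_vop s : tame q 0 (vop q s).
Proof. exact: tame_mser. Qed.

Lemma tame_site_op a : tame q a.2 (site_op a).
Proof.
rewrite -[X in tame _ X _]addn0; apply: tame_mul => //.
  by rewrite -[X in tame _ X _]muln1; apply: tame_exp => //; apply: tame_kfop.
by rewrite -[X in tame _ X _](muln0 a.1); apply: tame_exp => //; apply: tame_bfop.
Qed.

Lemma sum_nple (V : nmodType) (F : nat * nat -> V) a : (a.1 < N)%N -> (a.2 < N)%N ->
  \sum_(c : J | nple (pnat c) a) F (pnat c) =
  \sum_(i < a.2.+1) \sum_(j < a.1.+1) F (j : nat, i : nat).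
Proof.
move=> a1 a2; rewrite exchange_big /=.
rewrite (big_ord_widen N (fun j => \sum_(i < a.2.+1) F (j, i : nat)) a1).
under [RHS]eq_bigr do rewrite (big_ord_widen N (fun i => F (_, i)) a2).
by rewrite pair_big.
Qed.

(** The conjugation formula for E_a, with the inverse of [vop q l] moved to the other side. *)
Lemma site_exchange l m a : (a.1 < N)%N -> (a.2 < N)%N ->
  vop q l * (\sum_(c : J | nple (pnat c) a)
     (weight q l 1 (pnat c) * weight q m l (npsub a (pnat c))) *:
        (site_op (pnat c) * (vop q m * site_op (npsub a (pnat c)))))
  = (weight q m 1 a *: (vop q m * site_op a)) * vop q l.
Proof.
move=> a1 a2; have := kb_exchange q_nonroot_real l m a.2 a.1.
rewrite (sum_nple (fun c => (weight q l 1 c * weight q m l (npsub a c)) *: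
        (site_op c * (vop q m * site_op (npsub a c)))) a1 a2).
rewrite /weight /wt /= => E.
transitivity (qprod q m 1 (a.2 + a.1) *: (vop q m * kbq q a.2 a.1 * vop q l)).
  rewrite -E mulr_sumr; apply: eq_bigr => i _.
  rewrite mulr_sumr; apply: eq_bigr => j _.
  rewrite /kbq !(=^~ scalerAl, =^~ scalerAr) /site_op /= !mulrA.
  rewrite !scalerA; congr (_ *: _).
  rewrite (addnC j i) (addnC (a.1 - j)%N) !invfM /GRing.scale /=; ring.
rewrite /kbq !(=^~ scalerAl, =^~ scalerAr) !scalerA; congr (_ *: _).
by rewrite (addnC a.1) !invfM; ring.
Qed.

(** The inverse (l z)_oo / (z)_oo is again a power series in z, hence tame. *)
Lemma vop_inv l : exists W, [/\ tame q 0 W, W * vop q l = 1 & vop q l * W = 1].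
Proof.
exists (mser (vcoef q 1 l)); split; first exact: tame_mser.
  by rewrite mserM (vcoef_conv q_nonroot_real) vcoef_id mser1.
by rewrite mserM (vcoef_conv q_nonroot_real) vcoef_id mser1.
Qed.

Variable n : nat.
Variables (l : R) (m : 'I_n.+1 -> R).

(** In terms of the process, c_i is the gamma_i of the transfer matrix and the content of site i
    before the step is c_i + a_i - c_(i-1). After rotation under the trace, factor i depends on c
    only through c_(i-1), so the sum over c is the expansion of a product of sums. *)
Lemma trace_stationary (a : 'I_n.+1 -> nat * nat) :
  (forall i, (a i).1 < N)%N -> (forall i, (a i).2 < N)%N ->
  (0 < \sum_i (a i).2)%N ->
  \sum_(c : {ffun 'I_n.+1 -> J} | [forall i, nple (pnat (c (ord_pred i))) (a i)])
    (\prod_i (weight q l 1 (pnat (c i)) *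
              weight q (m i) l (npsub (a i) (pnat (c (ord_pred i)))))) *
    trace (\prod_i (vop q (m i) * site_op (npsub (a i) (pnat (c (ord_pred i)))) *
                    site_op (pnat (c i))))
  = (\prod_i weight q (m i) 1 (a i)) *
    trace (\prod_i (vop q (m i) * site_op (a i))).
Proof.
move=> a1 a2 ha.
pose E i c := (weight q l 1 (pnat c) * weight q (m i) l (npsub (a i) (pnat c))) *:
   (site_op (pnat c) * (vop q (m i) * site_op (npsub (a i) (pnat c)))).
have tE (i : 'I_n.+1) (c : J) : nple (pnat c) (a i) -> tame q (a i).2 (E i c).
  move=> /andP[_ ca]; apply: tameZ.
  have -> : (a i).2 = ((pnat c).2 + (0 + (npsub (a i) (pnat c)).2))%N.
    by rewrite add0n /npsub /= subnKC.
  apply: tame_mul (tame_site_op _) _ => //.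
  by apply: tame_mul (tame_vop _) (tame_site_op _).
have pred_inj : injective (@ord_pred n.+1) by apply: can_inj (@ord_predK _).
pose X : fop R := \prod_i (vop q (m i) * site_op (a i)).
pose Y : fop R := \prod_i (\sum_(c : J | nple (pnat c) (a i)) E i c).
transitivity (trace Y); last first.
  have [W [tW WV VW]] := vop_inv l.
  have tX : tame q (\sum_i (0 + (a i).2)) X.
    by apply: tame_prod => // i; apply: tame_mul (tame_vop _) (tame_site_op _).
  (* [vop q l] passes through all the factors in turn, and under the trace W cancels it. *)
  have -> : Y = W * (((\prod_i weight q (m i) 1 (a i)) *: X) * vop q l).
    rewrite -[Y]mul1r -WV -mulrA; congr (_ * _).
    rewrite /Y (@prod_intertwine _ _ _ _ (fun i => weight q (m i) 1 (a i) *: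
      (vop q (m i) * site_op (a i)))) => [|i]; first by rewrite scaler_prod.
    exact: site_exchange.
  have tX' := tame_mul hq (tameZ (\prod_i weight q (m i) 1 (a i)) tX) (tame_vop l).
  rewrite (traceC hq _ tW tX') -?mulrA ?VW ?mulr1.
    by rewrite traceZ //; apply: (tame_cvg hq _ tX).
  by rewrite add0n addn0.
transitivity (\sum_(c : {ffun 'I_n.+1 -> J} | [forall i, nple (pnat (c i)) (a i)])
    trace (\prod_i E i (c i))); last first.
  have tEc (c : {ffun 'I_n.+1 -> J}) : [forall i, nple (pnat (c i)) (a i)] ->
      tame q (\sum_i (a i).2) (\prod_i E i (c i)).
    move=> /forallP ca.
    have -> : \prod_i E i (c i) =
        \prod_i (if nple (pnat (c i)) (a i) then E i (c i) else 0).
      by apply: eq_bigr => i _; rewrite ca.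
    apply: tame_prod => // i; case: ifP => [|_]; first exact: tE.
    exact: tame0.
  rewrite -(@trace_sum _ _ hq _ _ _ _ _ ha tEc) /Y bigA_distr_big_dep.
  by congr (trace (fop_fun _)).
(* Shifting c by one site turns the bound c_i <= a_i into c_(i-1) <= a_i. *)
pose shift (c : {ffun 'I_n.+1 -> J}) := [ffun i => c (ord_pred i)].
have shift_inj : injective shift.
  move=> c c' /ffunP cc; apply/ffunP => i.
  by have := cc (ordS i); rewrite !ffunE ordSK.
rewrite [RHS](reindex_inj shift_inj) /=.
apply: eq_big => [c|c /forallP ca].
  by apply: eq_forallb => i; rewrite ffunE.
pose d i := npsub (a i) (pnat (c (ord_pred i))).
have sum_pred : (\sum_i (pnat (c i)).2 = \sum_i (pnat (c (ord_pred i))).2)%N.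
  by rewrite (reindex_inj pred_inj).
have sum_da : (\sum_i ((0 + (d i).2) + (pnat (c i)).2) = \sum_i (a i).2)%N.
  rewrite big_split /= sum_pred -big_split /=; apply: eq_bigr => i _.
  by rewrite add0n /d /npsub /= subnK //; have /andP[] := ca i.
rewrite (trace_rotate hq (a := fun i => (0 + (d i).2)%N)
  (b := fun i => (pnat (c i)).2)).
- transitivity (trace ((\prod_i (weight q l 1 (pnat (c (ord_pred i))) *
                                 weight q (m i) l (d i))) *:
      \prod_i (site_op (pnat (c (ord_pred i))) * (vop q (m i) * site_op (d i))))).
    rewrite traceZ; last first.
      apply: (tame_cvg hq ha); rewrite -sum_da.
      have -> : (\sum_i (0 + (d i).2 + (pnat (c i)).2) =
         \sum_i ((pnat (c (ord_pred i))).2 + (0 + (d i).2)))%N.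
        by rewrite big_split [RHS]big_split /= sum_pred addnC.
      apply: tame_prod => // i; apply: tame_mul (tame_site_op _) _ => //.
      exact: tame_mul (tame_vop _) (tame_site_op _).
    congr (_ * _); rewrite big_split [RHS]big_split /=; congr (_ * _).
    by rewrite [LHS](reindex_inj pred_inj).
  rewrite -scaler_prod; congr (trace (fop_fun _)).
  by apply: eq_bigr => i _; rewrite /E ffunE.
- by move=> i; apply: tame_mul (tame_vop _) (tame_site_op _).
- by move=> i; apply: tame_site_op.
- by rewrite sum_da.
Qed.

End Stationarity.

(** * Sums over configurations *)

Section Configurations.
Variables (L N : nat).
Let J : finType := ('I_N * 'I_N)%type.

Definition emb (c : {ffun 'I_L -> J}) : conf L := [ffun i => pnat (c i)].

Lemma emb_inj : injective emb.
Proof.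
move=> c c' /ffunP cc; apply/ffunP => i; have := cc i; rewrite !ffunE.
by case: (c i) (c' i) => [x y] [x' y'] [] /val_inj -> /val_inj ->.
Qed.

Lemma embP (s : conf L) :
  (forall i, (s i).1 < N /\ (s i).2 < N)%N -> exists c, s = emb c.
Proof.
move=> sN; exists [ffun i => (Ordinal (proj1 (sN i)), Ordinal (proj2 (sN i)))].
by apply/ffunP => i; rewrite !ffunE /pnat /=; case: (s i).
Qed.

(** A sum over a set is 0 by convention when its support is infinite. Here the support lies in a
    finite box, so the sum becomes one over a finite type. *)
Lemma fsum_emb (V : nmodType) (A : set (conf L)) (F : conf L -> V) :
  (forall s, A s -> F s != 0 -> exists c, s = emb c) ->
  (\sum_(s \in A) F s)%classic =
  \sum_(c : {ffun 'I_L -> J}) (if emb c \in A then F (emb c) else 0).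
Proof.
move=> FA; rewrite fsbig_mkcond.
rewrite (@fsbigE _ _ _ _ _ [seq emb c | c <- enum {ffun 'I_L -> J}]).
- rewrite big_map big_enum_cond; apply: eq_big => [c|c _].
    by apply/andP; split=> //; apply: mem_set.
  by [].
- by rewrite map_inj_uniq ?enum_uniq //; apply: emb_inj.
- by [].
- move=> s _; rewrite /patch; case: ifPn => // /set_mem sA.
  apply: contraNeq => /(FA _ sA)[c ->]; apply: map_f; exact: mem_enum.
Qed.

End Configurations.

Lemma sum_pair1 L (s : 'I_L -> nat * nat) : (\sum_i s i).1 = (\sum_i (s i).1)%N.
Proof. by rewrite (big_morph (fun x => x.1) (op1 := addn) (id1 := 0%N)). Qed.

Lemma sum_pair2 L (s : 'I_L -> nat * nat) : (\sum_i s i).2 = (\sum_i (s i).2)%N.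
Proof. by rewrite (big_morph (fun x => x.2) (op1 := addn) (id1 := 0%N)). Qed.

Lemma sector_bound L m (s : conf L) i : sector_confs m s ->
  ((s i).1 < (wt m).+1 /\ (s i).2 < (wt m).+1)%N.
Proof.
rewrite /sector_confs /= => <-; rewrite /wt sum_pair1 sum_pair2 !ltnS.
by split; rewrite (bigD1 i) //= [X in (_ <= _ + X)%N](bigD1 i) //=; lia.
Qed.

Lemma pairD_cancel (a b c : nat * nat) : a + b = a + c -> b = c.
Proof. by case: a b c => [a a'] [b b'] [c c'] [] /addnI -> /addnI ->. Qed.

Lemma sum_ord_pred (V : nmodType) L (F : 'I_L -> V) :
  \sum_i F (ord_pred i) = \sum_i F i.
Proof. by rewrite [RHS](reindex_inj (can_inj (@ord_predK L))). Qed.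

Section TransferCoefficients.
Variables (K : numFieldType) (L : nat) (q lambda : K) (mu : 'I_L -> K).

Definition path_weight (c a b : conf L) : K :=
  \prod_(i < L) Smx q lambda (mu i) (c i) (a i) (c (ord_pred i)) (b i).

Lemma path_weight_neq0 c a b : path_weight c a b != 0 ->
  forall i, c i + a i = c (ord_pred i) + b i /\ nple (c i) (b i).
Proof.
rewrite /path_weight => /prodf_neq0 h i; have {h} := h i isT.
rewrite /Smx; case: (c i + a i =P _) => [e|_]; last by rewrite mul0r eqxx.
move=> hP; split=> //; case: (boolP (nple (c i) (b i))) => // cb.
by move: hP; rewrite (Phi_eq0 _ _ _ cb) mulr0 eqxx.
Qed.

(** Summing c_i + a_i = c_(i-1) + b_i around the ring cancels the c_i. *)
Lemma path_weight_conserves c a b : path_weight c a b != 0 -> \sum_i a i = \sum_i b i.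
Proof.
move=> /path_weight_neq0 h; apply: (@pairD_cancel (\sum_i c i)).
rewrite -{2}(sum_ord_pred (fun i => c i)) -!big_split /=.
by apply: eq_bigr => i _; have [] := h i.
Qed.

Lemma transfer_coefE m a b : sector_confs m b ->
  transfer_coef q lambda mu a b =
  \sum_(c : {ffun 'I_L -> 'I_(wt m).+1 * 'I_(wt m).+1}) path_weight (emb c) a b.
Proof.
move=> bm; rewrite /transfer_coef (@fsum_emb L (wt m).+1).
  by apply: eq_bigr => c _; rewrite ifT // in_setT.
move=> c _ /path_weight_neq0 h; apply: embP => i.
have [_ /andP[h1 h2]] := h i; have [b1 b2] := sector_bound i bm.
by split; [apply: leq_ltn_trans b1 | apply: leq_ltn_trans b2].
Qed.

Lemma transfer_coef_conserves m a b : sector_confs m b ->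
  transfer_coef q lambda mu a b != 0 -> sector_confs m a.
Proof.
move=> bm; rewrite (transfer_coefE a bm) => h.
have : exists c : {ffun 'I_L -> 'I_(wt m).+1 * 'I_(wt m).+1},
    path_weight (emb c) a b != 0.
  apply/existsP; apply: contraNT h; rewrite negb_exists => /forallP h.
  by rewrite big1 // => c _; have := h c; rewrite negbK => /eqP.
by case=> c /path_weight_conserves; rewrite /sector_confs /= bm.
Qed.

End TransferCoefficients.

Section FreeModule.
Variables (K : numFieldType) (L N : nat).
Let J : finType := ('I_N * 'I_N)%type.

Lemma mcoeff_ket (s t : conf L) : mcoeff s (ket K t) = (t == s)%:R.
Proof. by rewrite /ket mcoeffU. Qed.

Lemma mcoeff_fsum (A : set (conf L)) (F : conf L -> K) s :
  (forall s, A s -> F s != 0 -> exists c : {ffun 'I_L -> J}, s = emb c) ->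
  mcoeff s (\sum_(a \in A) F a *: ket K a)%classic = if s \in A then F s else 0.
Proof.
move=> FA; rewrite (@fsum_emb L N); last first.
  move=> t At Ft; apply: FA => //; apply: contraNneq Ft => ->.
  by rewrite scale0r.
rewrite raddf_sum /=.
have E (c : {ffun 'I_L -> J}) :
  mcoeff s (if emb c \in A then F (emb c) *: ket K (emb c) else 0)
  = if emb c == s then (if s \in A then F s else 0) else 0.
  case: ifP => cA; last by rewrite mcoeff0; case: eqP => // <-; rewrite cA.
  by rewrite mcoeffZ mcoeff_ket; case: eqP => [<-|_]; rewrite ?mulr1 ?mulr0 ?cA.
rewrite (eq_bigr _ (fun c _ => E c)).
case: (pselect (exists c : {ffun 'I_L -> J}, s = emb c)) => [[c ->]|sN].
  rewrite (bigD1 c) //= eqxx big1 ?addr0 // => c' /negbTE cc.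
  by rewrite (inj_eq (@emb_inj L N)) cc.
rewrite big1 => [|c _]; last by case: eqP => // cs; case: sN; exists c.
case: ifPn => // /set_mem As; apply/esym/eqP; apply: contra_notT sN; exact: FA.
Qed.

End FreeModule.

Section SteadyState.
Variables (K : numFieldType) (L : nat) (q lambda : K) (mu : 'I_L -> K) (m : nat * nat).
Let J : finType := ('I_(wt m).+1 * 'I_(wt m).+1)%type.

Lemma sector_emb s : sector_confs m s -> exists c : {ffun 'I_L -> J}, s = emb c.
Proof. by move=> sm; apply: embP => i; apply: sector_bound. Qed.

Lemma mcoeff_mp_state s :
  mcoeff s (mp_state q mu m) = if s \in sector_confs m then mp_prob q mu s else 0.
Proof. by apply: mcoeff_fsum => t tm _; apply: sector_emb. Qed.

Lemma mcoeff_transfer_ket s b : sector_confs m b ->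
  mcoeff s (transfer_ket q lambda mu b) = transfer_coef q lambda mu s b.
Proof.
move=> bm; rewrite /transfer_ket (@mcoeff_fsum K L (wt m).+1) ?in_setT //.
by move=> t _ /(transfer_coef_conserves bm); apply: sector_emb.
Qed.

Lemma mcoeff_transfer_mp_state s :
  mcoeff s (transfer q lambda mu (mp_state q mu m)) =
  \sum_(b : {ffun 'I_L -> J} | emb b \in sector_confs m)
    mp_prob q mu (emb b) * transfer_coef q lambda mu s (emb b).
Proof.
rewrite /transfer raddf_sum /=; set v := mp_state q mu m.
rewrite -(@fsbigTE _ _ _ _ (msupp v)
  (fun b => mcoeff s (mcoeff b v *: transfer_ket q lambda mu b))).
  rewrite (@fsum_emb L (wt m).+1).
    rewrite [RHS]big_mkcond; apply: eq_bigr => b _.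
    rewrite in_setT mcoeffZ /v mcoeff_mp_state.
    case: ifPn => [/set_mem bm|_]; last by rewrite mul0r.
    by rewrite mcoeff_transfer_ket.
  move=> t _; rewrite mcoeffZ /v mcoeff_mp_state; case: ifPn => [/set_mem + _|_].
    exact: sector_emb.
  by rewrite mul0r eqxx.
by move=> b bv; rewrite mcoeffZ mcoeff_outdom ?mul0r.
Qed.

Lemma steady_state_mp :
  (forall a, sector_confs m a ->
     \sum_(b : {ffun 'I_L -> J} | emb b \in sector_confs m)
       mp_prob q mu (emb b) * transfer_coef q lambda mu a (emb b) = mp_prob q mu a) ->
  (exists2 s, sector_confs m s & mp_prob q mu s != 0) ->
  steady_state q lambda mu m (mp_state q mu m).
Proof.
move=> stat [s0 s0m s0n]; split.
- by move=> s; rewrite mcoeff_mp_state; case: ifPn => [/set_mem|_]; rewrite ?eqxx.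
- apply: contraNneq s0n => v0; have := mcoeff_mp_state s0.
  by rewrite v0 mcoeff0 ifT ?inE // => <-.
- apply/malgP => a; rewrite mcoeff_transfer_mp_state mcoeff_mp_state.
  case: ifPn => [/set_mem|am]; first exact: stat.
  rewrite big1 // => b /set_mem bm.
  have [->|/(transfer_coef_conserves bm) am'] :=
    eqVneq (transfer_coef q lambda mu a (emb b)) 0.
    by rewrite mulr0.
  by rewrite (mem_set am') in am.
Qed.

End SteadyState.

(** * Stationarity of the matrix product *)

Section MatrixProductOperator.
Variables (K : numFieldType) (q : K) (L : nat) (mu : 'I_L -> K).
Hypothesis mu0 : forall i, mu i != 0.

Definition mp_fop (s : conf L) : fop K :=
  \prod_i (vop q (mu i)^-1 * kb q (s i).2 (s i).1).

Lemma mp_operatorE s : mp_operator q mu s = mp_fop s.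
Proof.
rewrite /mp_operator /mp_fop.
rewrite (big_morph (@fop_fun K) (op1 := fun X Y => X \o Y) (id1 := id)) //.
apply: eq_bigr => i _; apply/funext => f.
by rewrite /kb !fop_mulE !fop_expE -bplus_ratioE.
Qed.

Lemma mp_probE s :
  mp_prob q mu s = (\prod_i weight q (mu i)^-1 1 (s i)) * trace (mp_fop s).
Proof.
rewrite /mp_prob mp_operatorE; congr (_ * _); apply: eq_bigr => i _.
by rewrite /weight qprod_qpoch // mulr1.
Qed.

End MatrixProductOperator.

Section RealStationarity.
Variables (R : realType) (q lambda : R) (n : nat) (mu : 'I_n.+1 -> R) (m : nat * nat).
Hypothesis hq : 0 < q < 1.
Hypothesis hmu : forall i, 0 < mu i < lambda.
Hypothesis hlambda : lambda < 1.
Hypothesis hm2 : (0 < m.2)%N.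

Let mu_gt0 i : 0 < mu i. Proof. by case/andP: (hmu i). Qed.
Let mu_neq0 i : mu i != 0. Proof. by rewrite gt_eqF. Qed.
Let mu_lt1 i : mu i < 1. Proof. by case/andP: (hmu i) => _ /lt_trans->. Qed.
Let lambda_neq0 : lambda != 0.
Proof. by case/andP: (hmu ord0) => /lt_trans h /h h'; rewrite gt_eqF. Qed.

Lemma qpoch_gt0 (z : R) k : z < 1 -> 0 < z -> 0 < qpoch q z k.
Proof.
move=> z1 z0; have /andP[q0 q1] := hq; apply: prodr_gt0 => j _; rewrite subr_gt0.
by apply: le_lt_trans z1; rewrite ler_piMr ?exprn_ile1 // ltW.
Qed.

Lemma tame_mp_fop (s : conf n.+1) : tame q (\sum_i (s i).2) (mp_fop q mu s).
Proof.
rewrite (eq_bigr (fun i => 0 + (s i).2)%N) //.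
apply: tame_prod => // i.
exact: tame_mul (tame_vop _ _) (tame_site_op hq _).
Qed.

Lemma mp_fop_cvg s : sector_confs m s -> trace_convergent (mp_fop q mu s).
Proof.
move=> sm; apply: tame_cvg (tame_mp_fop s) => //.
by rewrite -sum_pair2 (_ : \sum_i s i = m).
Qed.

Let J : finType := ('I_(wt m).+1 * 'I_(wt m).+1)%type.

(** For fixed a and c the local conservation laws determine b. Exchanging the two sums therefore
    leaves at most one b for each c, and [trace_stationary] evaluates the result. *)
Lemma mp_prob_stationary (a : conf n.+1) : sector_confs m a ->
  \sum_(b : {ffun 'I_n.+1 -> J} | emb b \in sector_confs m)
    mp_prob q mu (emb b) * transfer_coef q lambda mu a (emb b) = mp_prob q mu a.
Proof.
move=> am; rewrite mp_probE //.
have ha : (0 < \sum_i (a i).2)%N by rewrite -sum_pair2 (_ : \sum_i a i = m).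
have aN i := sector_bound i am.
rewrite -(@trace_stationary R q (wt m).+1 hq n lambda^-1 (fun i => (mu i)^-1) a
  (fun i => (aN i).1) (fun i => (aN i).2) ha).
transitivity (\sum_(b : {ffun 'I_n.+1 -> J} | emb b \in sector_confs m)
   \sum_(c : {ffun 'I_n.+1 -> J})
     mp_prob q mu (emb b) * path_weight q lambda mu (emb c) a (emb b)).
  by apply: eq_bigr => b /set_mem bm; rewrite (transfer_coefE _ _ _ _ bm) mulr_sumr.
rewrite exchange_big /= [RHS]big_mkcond; apply: eq_bigr => c _.
case: ifPn => [/forallP ca|ca]; last first.
  (* c_i + a_i = c_(i-1) + b_i and c_i <= b_i force c_(i-1) <= a_i, which fails at some site. *)
  rewrite big1 // => b /set_mem bm.
  have [->|/path_weight_neq0 h] :=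
    eqVneq (path_weight q lambda mu (emb c) a (emb b)) 0.
    by rewrite mulr0.
  case/negP: ca; apply/forallP => i; have := h i; rewrite !ffunE.
  case: (c i) (c (ord_pred i)) (b i) (a i) => c1 c2 [d1 d2] [b1 b2] [a1 a2].
  rewrite /nple /= => -[[e1 e2] /andP[h1 h2]]; move: e1 e2 h1 h2.
  by rewrite /GRing.add /=; lia.
pose d i := npsub (a i) (pnat (c (ord_pred i))).
have da i : a i = pnat (c (ord_pred i)) + d i.
  have := ca i; rewrite /d /npsub /nple; case: (a i) => a1 a2 /= /andP[h1 h2].
  by congr (_, _); rewrite /GRing.add /= subnKC.
pose b0 : conf n.+1 := [ffun i => pnat (c i) + d i].
have b0m : sector_confs m b0.
  rewrite /sector_confs /= -(_ : \sum_i a i = m) //.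
  rewrite (eq_bigr _ (fun i _ => da i)) (eq_bigr _ (fun i _ => ffunE _ i)) !big_split /=.
  by rewrite (sum_ord_pred (fun i => pnat (c i))).
have [b b0E] := sector_emb b0m.
have bE i : pnat (b i) = pnat (c i) + d i by have /ffunP/(_ i) := b0E; rewrite !ffunE.
rewrite (bigD1 b) /=; last by rewrite -b0E; apply: mem_set.
rewrite [X in _ + X]big1 ?addr0; last first.
  move=> b' /andP[/set_mem bm' bb'].
  have [->|/path_weight_neq0 h] :=
    eqVneq (path_weight q lambda mu (emb c) a (emb b')) 0.
    by rewrite mulr0.
  case/eqP: bb'; apply: (@emb_inj n.+1 (wt m).+1); rewrite -b0E; apply/ffunP => i.
  have [] := h i; rewrite !ffunE => e _.
  apply: (@pairD_cancel (pnat (c (ord_pred i)))); rewrite -e [in LHS]da.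
  by rewrite addrCA.
rewrite -b0E mp_probE //.
have PE i : Smx q lambda (mu i) (emb c i) (a i) (emb c (ord_pred i)) (b0 i) =
    Phi q lambda (mu i) (pnat (c i)) (pnat (c i) + d i).
  by rewrite /Smx !ffunE (_ : _ == _) ?mul1r // [in X in X == _]da addrCA.
have b0c i : npsub (b0 i) (pnat (c i)) = d i.
  rewrite ffunE /npsub; case: (d i) (pnat (c i)) => d1 d2 [c1 c2] /=.
  by congr (_, _); rewrite /GRing.add /= addKn.
have W i :
   Phi q lambda (mu i) (pnat (c i)) (pnat (c i) + d i) * weight q (mu i)^-1 1 (b0 i) =
   q ^+ ((d i).1 * (c i).2) *
   (weight q lambda^-1 1 (pnat (c i)) * weight q (mu i)^-1 lambda^-1 (d i)).
  have b0i : b0 i = pnat (c i) + d i by rewrite ffunE.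
  rewrite -b0i Phi_weight ?b0c //.
  - by have /(congr1 fst) /= <- := b0c i.
  - exact: q_nonroot_real.
  - by move=> k; rewrite gt_eqF // qpoch_gt0.
  - by rewrite b0i /nple /GRing.add /= !leq_addr.
rewrite mulrAC -big_split /= (eq_bigr _ (fun i _ => congr1 ( *%R _) (PE i))).
rewrite (eq_bigr _ (fun i _ => etrans (mulrC _ _) (W i))) big_split /= mulrAC mulrC.
congr (_ * _).
(* The remaining powers of q enter the trace, where [kb_split] absorbs them site by site. *)
rewrite -traceZ; last exact: mp_fop_cvg.
congr (trace (fop_fun _)); rewrite /mp_fop -scaler_prod; apply: eq_bigr => i _.
rewrite scalerAr -mulrA; congr (_ * _).
by rewrite /site_op -kb_split ffunE; congr (_ *: kb q _ _); apply: addnC.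
Qed.

End RealStationarity.

(** * Nonvanishing by positivity *)

Section Positivity.
Variables (R : realType) (q : R) (n : nat) (mu : 'I_n.+1 -> R) (m : nat * nat).
Hypothesis hq : 0 < q < 1.
Hypothesis hmu : forall i, 0 < mu i < 1.
Hypothesis hm2 : (0 < m.2)%N.

Let q0 : 0 < q. Proof. by case/andP: hq. Qed.
Let mu_gt0 i : 0 < mu i. Proof. by case/andP: (hmu i). Qed.
Let mu_neq0 i : mu i != 0. Proof. by rewrite gt_eqF. Qed.

Definition fock_ge0 (f : fock R) := forall r, 0 <= f r.

Lemma one_sub_qX_gt0 k : 0 < 1 - q ^+ k.+1.
Proof. by have /andP[? ?] := hq; rewrite subr_gt0 exprn_ilt1 // ltW. Qed.

Lemma vcoef_gt0 i k : 0 < vcoef q (mu i)^-1 1 k.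
Proof.
have /andP[? q1] := hq; rewrite /vcoef qprod_qpoch // mulr1.
have /andP[? ?] := hmu i.
by rewrite divr_gt0 ?mulr_gt0 ?invr_gt0 ?exprn_gt0 ?qpoch_gt0.
Qed.

Lemma vop_ge0 i f : fock_ge0 f -> fock_ge0 (vop q (mu i)^-1 f).
Proof. by move=> f0 r; apply: sumr_ge0 => j _; rewrite mulr_ge0 // ltW // vcoef_gt0. Qed.

Lemma vop_gt0 i f r s : fock_ge0 f -> (s <= r)%N -> 0 < f s -> 0 < vop q (mu i)^-1 f r.
Proof.
move=> f0 sr fs; have h : (r - s < r.+1)%N by rewrite ltnS leq_subr.
rewrite /= /conv (bigD1 (Ordinal h)) //= subKn //.
apply: ltr_wpDr; last by rewrite mulr_gt0 // vcoef_gt0.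
by apply: sumr_ge0 => j _; rewrite mulr_ge0 // ltW // vcoef_gt0.
Qed.

Lemma bfop_ge0 f : fock_ge0 f -> fock_ge0 (bfop q f).
Proof. by move=> f0 r; rewrite mulr_ge0 // ltW // one_sub_qX_gt0. Qed.

Lemma kfop_ge0 f : fock_ge0 f -> fock_ge0 (kfop q f).
Proof. by move=> f0 r; rewrite mulr_ge0 // exprn_ge0 // ltW. Qed.

Lemma kb_ge0 i j f : fock_ge0 f -> fock_ge0 (kb q i j f).
Proof.
move=> f0; rewrite /kb fop_mulE !fop_expE; elim: i => [|i IHi] /=; last exact: kfop_ge0.
by elim: j => [|j IHj] //=; apply: bfop_ge0.
Qed.

Lemma kb_gt0 i j f r : fock_ge0 f -> 0 < f (r + j)%N -> 0 < kb q i j f r.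
Proof.
move=> f0 fr; rewrite /kb fop_mulE !fop_expE; elim: i => [|i IHi] /=; last first.
  by rewrite mulr_gt0 // exprn_gt0.
elim: j r fr => [|j IHj] r; first by rewrite addn0.
by rewrite addnS -addSn => fr; rewrite /= mulr_gt0 ?one_sub_qX_gt0 // IHj.
Qed.

Lemma mp_fop_ge0 s f : fock_ge0 f -> fock_ge0 (mp_fop q mu s f).
Proof.
move=> f0; rewrite /mp_fop; elim/big_rec: _ => // i X _ X0.
by rewrite 2!fop_mulE; apply: vop_ge0; apply: kb_ge0.
Qed.

(** With all particles on the first site, the other factors are pure power series in b_+, which
    makes a positive diagonal entry easy to locate. *)
Definition head_conf : conf n.+1 := [ffun i => if i == ord0 then m else 0].

Lemma head_conf_sector : sector_confs m head_conf.
Proof.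
rewrite /sector_confs /= (bigD1 ord0) //= ffunE eqxx big1 ?addr0 // => i /negbTE i0.
by rewrite ffunE i0.
Qed.

(** A path of positive amplitude from |m_1> to itself: the later sites keep |m_1>, b^(m_1) lowers it
    to |0>, k acts there as 1, and the first series raises it back. *)
Lemma head_conf_diag_gt0 : 0 < diag (mp_fop q mu head_conf) m.1.
Proof.
rewrite /diag /mp_fop big_ord_recl ffunE eqxx 2!fop_mulE.
have ket0 : fock_ge0 (fock_ket R m.1) by move=> r; rewrite /fock_ket ler0n.
set W := \prod_(i < n) _.
have [W0 W1] : fock_ge0 (W (fock_ket R m.1)) /\ 0 < W (fock_ket R m.1) m.1.
  rewrite /W; elim/big_rec: _ => [|i X _ [X0 X1]].
    by split => //; rewrite /= /fock_ket eqxx ltr01.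
  have -> : head_conf (lift ord0 i) = (0%N, 0%N) by rewrite ffunE.
  rewrite 2!fop_mulE; split; first by apply: vop_ge0; apply: kb_ge0.
  exact: (@vop_gt0 _ _ _ m.1).
by apply: (@vop_gt0 _ _ _ 0%N) => //; [apply: kb_ge0 | apply: kb_gt0].
Qed.

Lemma mp_prob_head_conf : mp_prob q mu head_conf != 0.
Proof.
have /andP[_ q1] := hq.
rewrite mp_probE // mulf_neq0 //.
  apply/prodf_neq0 => i _; have /andP[? ?] := hmu i.
  rewrite gt_eqF // /weight qprod_qpoch // mulr1.
  by rewrite divr_gt0 ?mulr_gt0 ?invr_gt0 ?exprn_gt0 ?qpoch_gt0.
rewrite gt_eqF //; set u := diag (mp_fop q mu head_conf).
have u0 r : 0 <= u r.
  by apply: mp_fop_ge0 => t; rewrite /fock_ket ler0n.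
(* The diagonal entries being nonnegative, the trace is at least the partial sum through index
   m_1. *)
apply: (@lt_le_trans _ _ (series u m.1.+1)).
  by rewrite /series /= big_nat_recr //= ltr_wpDl ?head_conf_diag_gt0 // sumr_ge0.
apply: nondecreasing_cvgn_le.
  apply/nondecreasing_seqP => k.
  by rewrite /series /= big_nat_recr //= lerDl.
apply: tame_cvg (tame_mp_fop _ hq _) => //.
rewrite -sum_pair2 (_ : \sum_i head_conf i = m) //; exact: head_conf_sector.
Qed.

End Positivity.

(** * From real to complex coefficients *)

Section Map.
Variables (K K' : numFieldType) (phi : {rmorphism K -> K'}) (q : K) (L : nat).

Lemma map_qpoch z k : qpoch (phi q) (phi z) k = phi (qpoch q z k).
Proof.
rewrite /qpoch rmorph_prod; apply: eq_bigr => j _.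
by rewrite rmorphB rmorphM rmorphXn rmorph1.
Qed.

Lemma map_qbinom k l : qbinom (phi q) k l = phi (qbinom q k l).
Proof.
rewrite /qbinom; case: ifP => _; last by rewrite rmorph0.
by rewrite !map_qpoch fmorph_div rmorphM.
Qed.

Lemma map_Phi lambda mu c b :
  Phi (phi q) (phi lambda) (phi mu) c b = phi (Phi q lambda mu c b).
Proof.
rewrite /Phi -!fmorph_div !map_qbinom !map_qpoch.
by rewrite -!rmorphXn -!rmorphM -!fmorph_div -!rmorphM.
Qed.

Lemma map_path_weight lambda (mu : 'I_L -> K) c a b :
  path_weight (phi q) (phi lambda) (phi \o mu) c a b = phi (path_weight q lambda mu c a b).
Proof.
rewrite /path_weight rmorph_prod; apply: eq_bigr => i _.
by rewrite /Smx map_Phi rmorphM rmorph_nat.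
Qed.

Lemma map_transfer_coef lambda (mu : 'I_L -> K) m a b : sector_confs m b ->
  transfer_coef (phi q) (phi lambda) (phi \o mu) a b = phi (transfer_coef q lambda mu a b).
Proof.
move=> bm; rewrite !(transfer_coefE _ _ _ _ bm) rmorph_sum.
by apply: eq_bigr => c _; rewrite map_path_weight.
Qed.

Lemma map_mp_operator (mu : 'I_L -> K) s f :
  mp_operator (phi q) (phi \o mu) s (phi \o f) = phi \o mp_operator q mu s f.
Proof.
rewrite /mp_operator; move: f.
apply: (big_ind2 (fun (X : fock K' -> fock K') (Y : fock K -> fock K) =>
  forall f, X (phi \o f) = phi \o Y f)) => //.
  by move=> X1 X2 Y1 Y2 h1 h2 f /=; rewrite h2 h1.
move=> i _ f /=.
have mapb j : iter j (bminus (phi q)) (phi \o f) = phi \o iter j (bminus q) f.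
  elim: j => // j /= ->; apply/funext => r.
  by rewrite /bminus /= rmorphM rmorphB rmorphXn rmorph1.
have mapk j g : iter j (kop (phi q)) (phi \o g) = phi \o iter j (kop q) g.
  elim: j => // j /= ->; apply/funext => r.
  by rewrite /kop /= rmorphM rmorphXn.
have mapp j g r : iter j (@bplus K') (phi \o g) r = phi (iter j (@bplus K) g r).
  by elim: j r => // j IHj [|r] /=; rewrite ?rmorph0.
rewrite mapb mapk; apply/funext => r; rewrite /bplus_ratio /= rmorph_sum.
by apply: eq_bigr => j _; rewrite mapp !map_qpoch !rmorphM !fmorphV rmorphXn.
Qed.

(** A trace is a limit, which a ring morphism need not preserve; hence the comparison of individual
    diagonal entries. *)
Lemma map_diag_mp_operator (mu : 'I_L -> K) s r :
  diag (mp_operator (phi q) (phi \o mu) s) r = phi (diag (mp_operator q mu s) r).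
Proof.
rewrite /diag (_ : fock_ket K' r = phi \o fock_ket K r); first by rewrite map_mp_operator.
by apply/funext => t; rewrite /fock_ket /= rmorph_nat.
Qed.

End Map.

Section Complex.
Variable R : realType.
Local Open Scope complex_scope.
Local Open Scope classical_set_scope.

(* The type R[i] alone does not carry the topology used in Defs for an abstract
   numFieldType. *)
Let C : numFieldType := R[i].
Let toC : {rmorphism R -> R[i]} := real_complex R.

Lemma real_complex_cvg (u : nat -> R) (l : R) :
  u n @[n --> \oo] --> l -> ((u n)%:C : C) @[n --> \oo] --> (l%:C : C).
Proof.
move=> ul; apply/cvgrPdist_lt => -[e e'].
(* A positive complex number has zero imaginary part, so the radius is a positive real. *)
rewrite ltcE /= => /andP[/eqP -> e0].
have /cvgrPdist_lt/(_ _ e0) := ul; apply: filterS => n.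
rewrite -rmorphB normc_def /= expr0n addr0 sqrtr_sqr => h.
by rewrite ltcE /= eqxx.
Qed.

Lemma complex_mp_trace (q : R) L (mu : 'I_L -> R) (s : conf L) :
  trace_convergent (mp_operator q mu s) ->
  trace_convergent (mp_operator q%:C (fun i => (mu i)%:C) s) /\
  trace (mp_operator q%:C (fun i => (mu i)%:C) s) = (trace (mp_operator q mu s))%:C.
Proof.
move=> cv.
have lim : series (diag (mp_operator q%:C (fun i => (mu i)%:C) s)) n @[n --> \oo]
    --> ((trace (mp_operator q mu s))%:C : C).
  rewrite (_ : series _ = fun n => (series (diag (mp_operator q mu s)) n)%:C).
    exact: real_complex_cvg.
  apply/funext => n; rewrite /series /= (rmorph_sum toC).
  by apply: eq_bigr => r _; apply: (map_diag_mp_operator toC).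
split; first by apply/cvg_ex; eexists; exact: lim.
by apply: cvg_lim => //; exact: norm_hausdorff.
Qed.

Lemma complex_mp_prob (q : R) L (mu : 'I_L -> R) (s : conf L) :
  trace_convergent (mp_operator q mu s) ->
  mp_prob q%:C (fun i => (mu i)%:C) s = (mp_prob q mu s)%:C.
Proof.
move=> cv; rewrite /mp_prob (complex_mp_trace cv).2 (rmorphM toC); congr (_ * _).
rewrite (rmorph_prod toC); apply: eq_bigr => i _.
rewrite (fmorph_div toC) !(rmorphM toC) (fmorphV toC) (rmorphXn toC).
by rewrite -!(map_qpoch toC).
Qed.

End Complex.

Local Open Scope complex_scope.

Theorem mainTheorem3 (R : realType) (L : nat) (q lambda : R) (mu : 'I_L -> R)
    (m : nat * nat) (hL : (1 <= L)%N) (hq : 0 < q < 1)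
    (hmu : forall i, 0 < mu i < lambda) (hlambda : lambda < 1)
    (hm1 : (1 <= m.1)%N) (hm2 : (1 <= m.2)%N) :
  (forall s : conf L, sector_confs m s ->
     trace_convergent (mp_operator q%:C (fun i => (mu i)%:C) s)) /\
  steady_state q%:C lambda%:C (fun i => (mu i)%:C) m
    (mp_state q%:C (fun i => (mu i)%:C) m).
Proof.
case: L mu hL hmu => [|n] mu hL hmu; first discriminate hL.
have mu_neq0 i : mu i != 0 by case/andP: (hmu i) => h _; rewrite gt_eqF.
have hmu1 i : 0 < mu i < 1.
  by case/andP: (hmu i) => -> /lt_trans->.
have cv s : sector_confs m s -> trace_convergent (mp_operator q mu s).
  by move=> sm; rewrite mp_operatorE //; exact: (mp_fop_cvg hq hm2 sm).
split.
  by move=> s /cv/complex_mp_trace[].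
apply: steady_state_mp.
  move=> a am; rewrite complex_mp_prob; last exact: cv.
  rewrite -(mp_prob_stationary hq hmu hlambda hm2 am) rmorph_sum.
  apply: eq_bigr => b /set_mem bm; rewrite rmorphM complex_mp_prob; last exact: cv.
  congr (_ * _).
  exact: (@map_transfer_coef R _ (real_complex R) q n.+1 lambda mu m a (emb b) bm).
exists (head_conf n m); first exact: head_conf_sector.
rewrite complex_mp_prob; last by apply: cv; exact: head_conf_sector.
by rewrite fmorph_eq0 mp_prob_head_conf.
Qed.
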